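(* Let $(X,Y)\sim P_{XY}$ be a pair of sources following the polynomial model $$X=\sum_{i=0}^{k-1}\beta_iY^i+N,\qquad N\sim\mathcal{N}(0,\sigma^2),$$ with $\boldsymbol\beta=[\beta_0,\dots,\beta_{k-1}]^T\in\mathbb{R}^k$. Given any rate $R>0$, the pair $(R,0)$ is achievable for the polynomial regression scheme with squared loss.
   Context: Sources: $X$ is the source to be encoded and $Y$, with $\mathbb{E}[Y]=0$ (taken without loss of generality), is side information available only at the decoder. The vector $\boldsymbol\beta$ is constant and unknown at the transmitter. For the coding scheme, $\boldsymbol\beta$ and the joint distribution $P_{XY}$ are unknown to the encoder and decoder, while the noise variance $\sigma^2$ is known at the encoder. Notation: for $y\in\mathbb{R}$, $\boldsymbol y^{\star}=[y^0,y^1,\dots,y^{k-1}]^T\in\mathbb{R}^k$. $\mathcal{F}$ is the set of polynomial functions $f:\mathbb{R}\to\mathbb{R}$ of the form $f(y)=\boldsymbol\alpha^T\boldsymbol y^{\star}$ with $\boldsymbol\alpha\in\mathbb{R}^k$. $\log$ is the base-2 logarithm. The training sequences $\boldsymbol X=[X_1,\dots,X_n]^T$ and $\boldsymbol Y=[Y_1,\dots,Y_n]^T$ consist of $n$ i.i.d. samples of $(X,Y)$. Scheme: a polynomial regression scheme at rate $R$ is a sequence $\{(e_n,d_n,R,\widehat f^{(n)})\}$ with an encoder $e_n:\mathcal{X}^n\to\{1,\dots,M_n\}$, a decoder $d_n:\mathcal{Y}^n\times\{1,\dots,M_n\}\to\mathcal{U}^n$ and a learner $t_n:\mathcal{Y}^n\times\mathcal{U}^n\to\mathcal{F}$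 such that $\limsup_{n\to\infty}\frac{\log M_n}{n}\le R$. Here $\mathcal{X},\mathcal{Y}$ are the alphabets of $X,Y$ and $\mathcal{U}$ is the alphabet of the decoder output. The decoder output $\boldsymbol U=d_n(\boldsymbol Y,e_n(\boldsymbol X))$ is the coded version of $\boldsymbol X$, the training sequence is $\boldsymbol Z=(\boldsymbol U,\boldsymbol Y)$, and the learner outputs the predictor $\widehat f^{(n)}(\boldsymbol Z,\cdot)\in\mathcal{F}$. Performance: the squared loss is $\ell(x,\hat x)=(x-\hat x)^2$. The minimum expected loss is $L^{\star}(\mathcal{F},\boldsymbol\beta)=\inf_{f\in\mathcal{F}}\mathbb{E}[\ell(X,f(Y))]$. The generalization error is the random variable $$G(\widehat f^{(n)},\boldsymbol\beta)=\mathbb{E}_{\tilde X\tilde Y}\big[\ell(\tilde X,\widehat f^{(n)}(\boldsymbol Z,\tilde Y))\,\big|\,\boldsymbol Z\big],$$ where $(\tilde X,\tilde Y)\sim P_{XY}$ is independent of $\boldsymbol Z$. Achievability: a pair $(R,\delta)$ is achievable if there exists a sequence $\{(e_n,d_n,R,\widehat f^{(n)})\}$ (a polynomial regression scheme at rate $R$) such that $$\limsup_{n\to\infty}\mathbb{E}_{\boldsymbol Z}\big[G(\widehat f^{(n)},\boldsymbol\beta)\big]\le L^{\star}(\mathcal{F},\boldsymbol\beta)+\delta.$$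
   Formalization: The expected squared loss is assumed finite for every f in F (for k ≥ 1, E[Y^{2(k-1)}] < ∞); otherwise the claim fails for almost every β, since G is infinite unless the top coefficient is recovered exactly. N is taken independent of Y, with σ > 0. *)

(* Defs.v *)
From HB Require Import structures.
From mathcomp Require Import all_boot all_order all_algebra finmap.
From mathcomp Require Import all_classical all_reals all_analysis.

Set Implicit Arguments.
Unset Strict Implicit.
Unset Printing Implicit Defensive.

Import Order.TTheory GRing.Theory Num.Theory.
Import numFieldNormedType.Exports.

Local Open Scope classical_set_scope.
Local Open Scope ring_scope.

Section independence.
Local Open Scope ereal_scope.
Context d (Omega : measurableType d) (R : realType) (P : probability Omega R).

Definition independent_rv d1 d2 (T1 : measurableType d1) (T2 : measurableType d2)
    (U : Omega -> T1) (V : Omega -> T2) : Prop :=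
  forall (A : set T1) (B : set T2), measurable A -> measurable B ->
    P (U @^-1` A `&` V @^-1` B) = P (U @^-1` A) * P (V @^-1` B).

Definition mutually_independent (I : choiceType) d1 (T1 : measurableType d1)
    (Z : I -> Omega -> T1) : Prop :=
  forall (J : {fset I}) (A : I -> set T1), (forall i, measurable (A i)) ->
    P (\bigcap_(i in [set` J]) (Z i @^-1` A i)) =
    \prod_(i <- J) P (Z i @^-1` A i).

Definition identically_distributed d1 (T1 : measurableType d1)
    (U V : Omega -> T1) : Prop :=
  forall A : set T1, measurable A -> P (U @^-1` A) = P (V @^-1` A).

End independence.

Section regression.
Context {R : realType}.

Definition ystar k (y : R) : 'cV[R]_k := \col_(i < k) y ^+ i.

Definition polyfun k (alpha : 'cV[R]_k) (y : R) : R :=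
  (alpha^T *m ystar k y) 0 0.

Definition polynomials k : set (R -> R) :=
  [set f | exists alpha : 'cV[R]_k, f = polyfun alpha].

Definition sqloss (x xhat : R) : R := (x - xhat) ^+ 2.

Definition log2 (x : R) : R := ln x / ln 2.

(* The first argument of [enc] is the noise variance: it is the only parameter
   of the source that the scheme may use, and only the encoder sees it.  The
   decoder output alphabet is the real line, and [lrn y u] is the predictor
   learned from the training sequence z = (u, y). *)
Record scheme (k : nat) (r : R) := Scheme {
  msgs : nat -> nat ;
  enc : R -> forall n, n.-tuple R -> 'I_(msgs n) ;
  dec : forall n, n.-tuple R -> 'I_(msgs n) -> n.-tuple R ;
  lrn : forall n, n.-tuple R -> n.-tuple R -> R -> R ;
  scheme_rate :
    (limn_esup (fun n => (log2 (msgs n)%:R / n%:R)%:E) <= r%:E)%E ;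
  lrn_polynomials : forall n (y u : n.-tuple R), polynomials k (lrn y u) ;
  measurable_enc : forall v n (m : 'I_(msgs n)),
    measurable (@enc v n @^-1` [set m]) ;
  measurable_dec : forall n (m : 'I_(msgs n)),
    measurable_fun [set: n.-tuple R] (fun y => dec y m) ;
  measurable_lrn : forall n,
    measurable_fun [set: (n.-tuple R * n.-tuple R) * R]
      (fun p => lrn p.1.1 p.1.2 p.2)
}.

Definition predictor k r (S : scheme k r) (v : R) n (x y : n.-tuple R) : R -> R :=
  lrn S y (dec y (enc S v x)).

Section source.
Context d (Omega : measurableType d) (P : probability Omega R).

Definition expected_loss (X Y : Omega -> R) (f : R -> R) : \bar R :=
  ('E_P[fun w => sqloss (X w) (f (Y w))])%E.

Definition min_loss k (X Y : Omega -> R) : \bar R :=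
  ereal_inf [set expected_loss X Y f | f in polynomials k].

(* [N] is noise, hence independent of the regressor [Y].  The last condition
   says that the squared loss has finite mean for every predictor of the class;
   for [0 < k] it amounts to a finite moment of [Y] of order [2 * (k - 1)]. *)
Definition polynomial_model k (beta : 'cV[R]_k) (sigma : R)
    (X Y N : {RV P >-> R}) : Prop :=
  [/\ forall w, X w = \sum_(i < k) beta i 0 * Y w ^+ i + N w,
      forall A, measurable A -> P (N @^-1` A) = normal_prob 0 sigma A,
      independent_rv P Y N,
      ('E_P[Y] = 0)%E
    & forall f, polynomials k f -> (expected_loss X Y f < +oo)%E].

Definition iid_sample (X Y : {RV P >-> R}) (Xs Ys : nat -> {RV P >-> R}) : Prop :=
  mutually_independent P (fun i w => (Xs i w, Ys i w)) /\
  forall i, identically_distributed P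
    (fun w => (Xs i w, Ys i w)) (fun w => (X w, Y w)).

(* As the test pair is independent of the training sequence, the conditional
   expectation defining the generalization error is the expected loss of the
   learned polynomial, held fixed, on a pair with the law of (X, Y). *)
Definition gen_error k r (S : scheme k r) (v : R) (X Y : {RV P >-> R})
    (Xs Ys : nat -> {RV P >-> R}) (n : nat) (w : Omega) : \bar R :=
  expected_loss X Y
    (predictor S v [tuple Xs i w | i < n] [tuple Ys i w | i < n]).

Definition mean_gen_error k r (S : scheme k r) (v : R) (X Y : {RV P >-> R})
    (Xs Ys : nat -> {RV P >-> R}) (n : nat) : \bar R :=
  (\int[P]_w gen_error S v X Y Xs Ys n w)%E.

End source.

(* The scheme is chosen before the source: [beta] and the joint law of (X, Y)
   are unknown to encoder, decoder and learner.  Only the variance [sigma ^+ 2]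
   is handed over, and to the encoder alone. *)
Definition achievable (k : nat) (r delta : R) : Prop :=
  exists S : scheme k r,
    forall (sigma : R) (beta : 'cV[R]_k)
           (d : measure_display) (Omega : measurableType d) (P : probability Omega R)
           (X Y N : {RV P >-> R}) (Xs Ys : nat -> {RV P >-> R}),
      0 < sigma -> polynomial_model beta sigma X Y N ->
      iid_sample X Y Xs Ys ->
      (limn_esup (mean_gen_error S (sigma ^+ 2) X Y Xs Ys)
         <= min_loss P k X Y + delta%:E)%E.

End regression.

(* Main.v *)
(* Only the first [m ^ 2] samples are described, each rounded to a grid of step
   [1 / m] on [-m, m], where [m] tends to infinity with the blocklength [n] so
   slowly that this costs at most [r * n] bits.  The learner runs stochastic
   gradient descent for the squared loss weighted by
   [w(y) = 1 / (1 + |ystar k y|^2)] and averages the iterates.  The weight makes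
   the regressors bounded, so the usual energy argument bounds the expected
   weighted excess loss by [O(1 / m)] plus the mean squared rounding error,
   using no moments but those of the expected loss itself.  As [w > 0], the
   weighted and unweighted excess losses are quadratic forms with the same
   kernel, hence comparable in finite dimension, and the excess loss tends to
   [0] for every law of the source, though without a uniform rate. *)
Require Import Defs.
From HB Require Import structures.
From mathcomp Require Import all_boot all_order all_algebra finmap.
From mathcomp Require Import all_classical all_reals all_analysis.
From mathcomp Require Import measurable_realfun ring lra zify.

Set Implicit Arguments.
Unset Strict Implicit.
Unset Printing Implicit Defensive.

Import Order.TTheory GRing.Theory Num.Theory.
Import numFieldNormedType.Exports.

Local Open Scope ring_scope.

(** * Comparison of quadratic forms *)

Section quadratic_forms.
Context {R : realType} {V : lmodType R}.
Implicit Types (a b : V -> V -> R) (x : R) (u v w : V).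

(** The law of [Y] may sit on a few points, so the Gram matrix of [ystar k Y] can be singular and
    [beta] need not be identifiable. The analysis therefore speaks of predictions and quadratic
    forms, never of recovering [beta]. The rounding error is neither centred nor independent of [Y]
    and the noise, so it does not average out as the noise does: Young's inequality absorbs its
    cross term into the descent at the price of a constant times its mean square, which is why the
    resolution has to grow. With step [1 / (6 m)] and [m ^ 2] steps, step times horizon is [m / 6]:
    the initial distance costs [6 |beta|^2 / m] and the noise [1 / (2 m)] times its power, with no
    tuning to the source. The comparison constant between the two excess losses depends on the
    source but occurs in the analysis only, so the scheme can be fixed beforehand. *)

Definition psd_form a :=
  [/\ forall u v, a u v = a v u,
      forall x u v w, a (x *: u + v) w = x * a u w + a v w
    & forall u, 0 <= a u u].

Lemma psd_form0 a v : psd_form a -> a 0 v = 0.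
Proof.
by case=> _ aL _; have := aL (-1) 0 0 v; rewrite scaler0 addr0 mulN1r addNr.
Qed.

Lemma psd_formZD a x u v : psd_form a ->
  a (x *: u + v) (x *: u + v) = x ^+ 2 * a u u + 2 * x * a u v + a v v.
Proof.
by move=> [aC aL _]; rewrite aL aC aL [a v (_ + _)]aC aL (aC v u); ring.
Qed.

(** Along the line [x *: u + v] the form is affine in [x] when [a u u = 0], and an affine
    nonnegative function is constant. *)
Lemma psd_form_isotropic a u v : psd_form a -> a u u = 0 -> a u v = 0.
Proof.
move=> aP u0; apply/eqP/negP => /negP uv0.
(* The coefficient is chosen so that the form takes the value [-1]. *)
have [_ _ /(_ ((- (a v v + 1) / (2 * a u v)) *: u + v))] := aP.
rewrite psd_formZD// u0 mulr0 add0r.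
by rewrite (_ : 2 * _ * _ = - (a v v + 1)); [lra|field].
Qed.

(** Nonnegativity at [v - u] bounds the cross term. This stands in for orthogonality with respect to
    [a], as the Gram-Schmidt step below orthogonalises for [b] only. *)
Lemma psd_formD_le a u v : psd_form a ->
  a (u + v) (u + v) <= 2 * a u u + 2 * a v v.
Proof.
move=> aP; have [_ _ /(_ ((-1) *: u + v))] := aP.
by rewrite -{3 4}(scale1r u) !psd_formZD//; lra.
Qed.

(* Gram-Schmidt step on the first vector.  When [b (f 0) (f 0) = 0] the
   coefficients [_ / 0 = 0] leave the other vectors unchanged, which is right
   because [f 0] is then orthogonal to everything. *)
Lemma psd_form_comparison a b : psd_form a -> psd_form b ->
  (forall u, b u u = 0 -> a u u = 0) ->
  forall n (f : nat -> V), exists2 C : R, 0 <= C & forall c : nat -> R,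
    let v := \sum_(i < n) c i *: f i in a v v <= C * b v v.
Proof.
move=> aP bP ab; elim=> [|n IH] f.
  exists 0 => // c /=; rewrite big_ord0 mul0r.
  by rewrite psd_form0.
pose g j := b (f 0%N) (f j.+1) / b (f 0%N) (f 0%N).
(* The induction quantifies over families of vectors so that it applies to the corrected ones. *)
have [C C0 CP] := IH (fun j => f j.+1 - g j *: f 0%N).
have [_ _ a0] := aP; have [bC bL b0] := bP.
have A0 := a0 (f 0%N); have B0 := b0 (f 0%N).
(* The form [b] splits exactly over [x *: f 0] and the orthogonal rest [v'], while [a] splits up to
   the factor 2 of [psd_formD_le]. *)
exists (2 * (a (f 0%N) (f 0%N) / b (f 0%N) (f 0%N)) + 2 * C).
  by rewrite addr_ge0 ?mulr_ge0 ?invr_ge0 ?a0 ?b0.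
move=> c; rewrite big_ord_recl /=.
set v' := \sum_(i < n) c i.+1 *: (f i.+1 - g i *: f 0%N).
pose x := c 0%N + \sum_(i < n) c i.+1 * g i.
have -> : c 0%N *: f 0%N + \sum_(i < n) c (bump 0 i) *: f (bump 0 i)
    = x *: f 0%N + v'.
  rewrite /x /v' scalerDl -addrA; congr (_ + _).
  rewrite scaler_suml -big_split /=; apply: eq_bigr => i _.
  by rewrite scalerBr scalerA addrC subrK.
have gE j : b (f j.+1 - g j *: f 0%N) (f 0%N) = 0.
  rewrite addrC -scaleNr bL [b (f j.+1) _]bC /g.
  have [z|nz] := eqVneq (b (f 0%N) (f 0%N)) 0.
    by rewrite (psd_form_isotropic _ bP z) mul0r oppr0 mul0r add0r.
  by rewrite mulNr divfK// addNr.
have v'E : b (f 0%N) v' = 0.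
  rewrite bC /v'; elim/big_rec : _ => [|i w _ w0].
    by rewrite psd_form0.
  by rewrite bL gE w0 mulr0 addr0.
apply: le_trans (psd_formD_le _ _ aP) _.
rewrite (psd_formZD x _ v' bP) v'E mulr0 addr0.
have -> : a (x *: f 0%N) (x *: f 0%N) = x ^+ 2 * a (f 0%N) (f 0%N).
  have [aC _ _] := aP.
  by rewrite -[x *: _]addr0 psd_formZD// aC !psd_form0// mulr0 !addr0.
have Cv := CP (fun i => c i.+1); rewrite -/v' /= in Cv.
(* If [b] vanishes at [f 0], the kernel hypothesis makes [a] vanish there too, so the convention
   [_ / 0 = 0] gives the right ratio. *)
have AE : a (f 0%N) (f 0%N) =
    a (f 0%N) (f 0%N) / b (f 0%N) (f 0%N) * b (f 0%N) (f 0%N).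
  have [z|nz] := eqVneq (b (f 0%N) (f 0%N)) 0; first by rewrite z mulr0 ab.
  by rewrite divfK.
have t0 : 0 <= a (f 0%N) (f 0%N) / b (f 0%N) (f 0%N) by rewrite divr_ge0.
have := b0 v'; have := sqr_ge0 x; move: AE t0 Cv.
set q := _ / _.
move: (a (f 0%N) _) (b (f 0%N) _) (a v' v') (b v' v') (x ^+ 2) A0 B0.
move=> A B A' B' X A0 B0 -> q0 A'B' X0 B'0.
have h1 : 0 <= q * B' by exact: mulr_ge0.
have h2 : 0 <= C * (X * B) by rewrite !mulr_ge0.
by nra.
Qed.

End quadratic_forms.

(** * Weighted stochastic gradient descent *)

Section stochastic_gradient.
Context {R : realType} {k : nat}.
Implicit Types (s : k.-tuple R) (v : 'cV[R]_k) (eta y : R).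

Lemma polyfunE v y : polyfun v y = \sum_(i < k) v i 0 * y ^+ i.
Proof. by rewrite /polyfun mxE; apply: eq_bigr => i _; rewrite !mxE. Qed.

Lemma polyfunZD (c : R) u v y :
  polyfun (c *: u + v) y = c * polyfun u y + polyfun v y.
Proof. by rewrite /polyfun linearP mulmxDl -scalemxAl !mxE. Qed.

Lemma polyfun0 y : polyfun (0 : 'cV[R]_k) y = 0.
Proof. by rewrite polyfunE big1// => i _; rewrite mxE mul0r. Qed.

Lemma polyfunB u v y : polyfun (u - v) y = polyfun u y - polyfun v y.
Proof. by rewrite -scaleN1r addrC polyfunZD mulN1r addrC. Qed.

Lemma polyfun_sum n (f : 'I_n -> 'cV[R]_k) y :
  polyfun (\sum_(i < n) f i) y = \sum_(i < n) polyfun (f i) y.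
Proof.
rewrite polyfunE; under eq_bigr do rewrite summxE mulr_suml.
by rewrite exchange_big; apply: eq_bigr => i _; rewrite polyfunE.
Qed.

Definition col_of s : 'cV[R]_k := \col_(i < k) tnth s i.

Definition sqnorm v : R := \sum_(i < k) (v i 0) ^+ 2.

(* Dividing by [1 + |ystar k y|^2] bounds the regressors, so that no moment of
   [Y] beyond those of the expected loss is ever needed. *)
Definition weight y : R := (1 + \sum_(i < k) (y ^+ i) ^+ 2)^-1.

(** A gradient step for half the weighted squared loss at the sample [z = (x, y)]. Iterates are
    tuples, whose product sigma-algebra serves the measurability proofs; [col_of] returns to
    columns. *)
Definition sgd_step eta s (z : R * R) : k.-tuple R :=
  [tuple tnth s i - eta * weight z.2 * (polyfun (col_of s) z.2 - z.1) * z.2 ^+ i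
   | i < k].

Fixpoint sgd eta (z : nat -> R * R) t : k.-tuple R :=
  if t is t'.+1 then sgd_step eta (sgd eta z t') (z t') else [tuple 0 | i < k].

(** The average runs over the iterates preceding each of the [T] steps, because the energy
    inequality of a step controls the error at its starting point. *)
Definition sgd_mean eta (z : nat -> R * R) T : 'cV[R]_k :=
  T%:R^-1 *: \sum_(t < T) col_of (sgd eta z t).

Lemma sum_sq_ge0 y : 0 <= \sum_(i < k) (y ^+ i) ^+ 2.
Proof. by apply: sumr_ge0 => i _; exact: sqr_ge0. Qed.

Lemma weight_gt0 y : 0 < weight y.
Proof. by rewrite invr_gt0 ltr_pwDl// sum_sq_ge0. Qed.

Lemma weight_le1 y : weight y <= 1.
Proof. by rewrite invf_le1 ?lerDl ?ltr_pwDl ?sum_sq_ge0. Qed.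

Lemma weight_sum_le1 y : weight y * \sum_(i < k) (y ^+ i) ^+ 2 <= 1.
Proof.
by rewrite ler_pdivrMl ?ltr_pwDl ?sum_sq_ge0// mulr1 lerDr.
Qed.

Lemma sqnorm_ge0 v : 0 <= sqnorm v.
Proof. by apply: sumr_ge0 => i _; exact: sqr_ge0. Qed.

(** Expanding the squared distance gives [-2 eta w a^2], cross terms and a quadratic term. The
    weight bounds the latter by [3 eta^2 w (a^2 + noise^2 + e^2)]; Young bounds the cross term in
    [e] by [eta w (a^2 / 2 + 2 e^2)]. For [eta <= 1/6], [3 eta^2 <= eta / 2], so at least
    [eta w a^2] of descent survives. The cross term in [noise] is kept linear, to vanish in the
    mean. *)
Lemma sgd_step_descent eta s beta x y noise :
  0 <= eta <= 6^-1 ->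
  let a := polyfun (col_of s - beta) y in
  let e := x - (polyfun beta y + noise) in
  sqnorm (col_of (sgd_step eta s (x, y)) - beta) + eta * (weight y * a ^+ 2)
  <= sqnorm (col_of s - beta) + 2 * eta * (weight y * a * noise)
     + 3 * eta * e ^+ 2 + 3 * eta ^+ 2 * noise ^+ 2.
Proof.
move=> /andP[eta0 eta6]; cbv zeta.
set a := polyfun (_ - beta) y; set e := x - _.
pose c := eta * weight y * (a - noise - e).
have -> : sqnorm (col_of (sgd_step eta s (x, y)) - beta) =
    sqnorm (col_of s - beta) - 2 * c * a
      + c ^+ 2 * \sum_(i < k) (y ^+ i) ^+ 2.
  rewrite /sqnorm /a (polyfunE _ y) mulr_sumr mulr_sumr -sumrB -big_split /=.
  apply: eq_bigr => i _; rewrite !mxE tnth_mktuple /=.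
  have -> : polyfun (col_of s) y - x = a - noise - e.
    by rewrite /a polyfunB /e; ring.
  by rewrite -/c; ring.
have w0 := weight_gt0 y; have w1 := weight_le1 y; have ws := weight_sum_le1 y.
have le1 : c ^+ 2 * \sum_(i < k) (y ^+ i) ^+ 2
    <= eta ^+ 2 * weight y * (a - noise - e) ^+ 2.
  rewrite [leLHS](_ : _ = eta ^+ 2 * weight y * (a - noise - e) ^+ 2
     * (weight y * \sum_(i < k) (y ^+ i) ^+ 2)); last by rewrite /c; ring.
  by rewrite ler_piMr ?(mulr_ge0 (mulr_ge0 (sqr_ge0 _) (ltW w0)) (sqr_ge0 _)).
have le2 : (a - noise - e) ^+ 2 <= 3 * (a ^+ 2 + noise ^+ 2 + e ^+ 2).
  by have := sqr_ge0 (a + noise); have := sqr_ge0 (a + e);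
    have := sqr_ge0 (noise - e); nra.
have le3 : 2 * (a * e) <= a ^+ 2 / 2 + 2 * e ^+ 2.
  by have := sqr_ge0 (a - 2 * e); nra.
have ew0 : 0 <= eta * weight y by rewrite mulr_ge0// ltW.
have e2w0 : 0 <= eta ^+ 2 * weight y by exact: mulr_ge0 (sqr_ge0 _) (ltW w0).
have le2' := ler_wpM2l e2w0 le2.
have le3' := ler_wpM2l ew0 le3.
have ee : eta ^+ 2 <= eta * 6^-1 by rewrite expr2 ler_wpM2l.
have le4 : eta ^+ 2 * weight y <= eta * weight y * 6^-1.
  by rewrite [leRHS]mulrAC ler_wpM2r// ltW.
have le5 := ler_wpM2r (sqr_ge0 a) le4.
have le6 := ler_wpM2r (sqr_ge0 e) le4.
have le7 : eta * weight y * e ^+ 2 <= eta * e ^+ 2.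
  by rewrite ler_wpM2r ?sqr_ge0// ler_piMr.
have le8 : eta ^+ 2 * weight y * noise ^+ 2 <= eta ^+ 2 * noise ^+ 2.
  by rewrite ler_wpM2r ?sqr_ge0// ler_piMr// sqr_ge0.
have le9 : 0 <= eta * e ^+ 2 by exact: mulr_ge0 (sqr_ge0 _).
by rewrite /c in le1 *; lra.
Qed.

(** The gap is the empirical variance. *)
Lemma sqr_mean_le n (f : 'I_n -> R) : (0 < n)%N ->
  (n%:R^-1 * \sum_(i < n) f i) ^+ 2 <= n%:R^-1 * \sum_(i < n) (f i) ^+ 2.
Proof.
move=> n0; set S := \sum_(i < n) f i; pose m := n%:R^-1 * S.
have nn0 : n%:R != 0 :> R by rewrite pnatr_eq0 -lt0n.
have sE : \sum_(i < n) (f i - m) ^+ 2 =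
    \sum_(i < n) (f i) ^+ 2 - 2 * m * S + n%:R * m ^+ 2.
  have -> : n%:R * m ^+ 2 = \sum_(i < n) m ^+ 2.
    by rewrite sumr_const card_ord mulr_natl.
  by rewrite /S mulr_sumr -sumrB -big_split /=; apply: eq_bigr => i _; ring.
have : 0 <= n%:R^-1 * \sum_(i < n) (f i - m) ^+ 2.
  by rewrite mulr_ge0 ?invr_ge0//; apply: sumr_ge0 => i _; exact: sqr_ge0.
by rewrite sE mulrDr mulKf// mulrBr (mulrCA _ (2 * m)) -/m; lra.
Qed.

Lemma sgd_mean_sqr_le eta z T v y : (0 < T)%N ->
  polyfun (sgd_mean eta z T - v) y ^+ 2 <=
  T%:R^-1 * \sum_(t < T) polyfun (col_of (sgd eta z t) - v) y ^+ 2.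
Proof.
move=> T0; apply: le_trans (sqr_mean_le _ T0).
have TT0 : T%:R != 0 :> R by rewrite pnatr_eq0 -lt0n.
under [X in _ <= (_ * X) ^+ 2]eq_bigr do rewrite polyfunB.
rewrite sumrB sumr_const card_ord mulrBr -[polyfun v y *+ T]mulr_natl mulKf//.
rewrite polyfunB -polyfun_sum -[sgd_mean _ _ _]addr0 polyfunZD.
by rewrite polyfun0 addr0.
Qed.

End stochastic_gradient.

Arguments weight {R} k y.
Arguments weight_gt0 {R} k y.
Arguments weight_le1 {R} k y.

(** * Independence *)

Section independence.
Local Open Scope classical_set_scope.
Local Open Scope ereal_scope.
Context d (Omega : measurableType d) (R : realType) (P : probability Omega R).
Context d1 d2 (T1 : measurableType d1) (T2 : measurableType d2).

Lemma measurable_preimage d3 (T3 : measurableType d3) d4 (T4 : measurableType d4)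
    (f : T3 -> T4) (A : set T4) :
  measurable_fun [set: T3] f -> measurable A -> measurable (f @^-1` A).
Proof. by move=> mf mA; rewrite -[_ @^-1` _]setTI; exact: mf. Qed.

(** Independence is a statement on rectangles; uniqueness of the product measure extends it to all
    measurable sets. *)
Lemma independent_rv_pair (U : {mfun Omega >-> T1}) (V : {mfun Omega >-> T2}) :
  independent_rv P U V -> forall C : set (T1 * T2), measurable C ->
  (distribution P U \x distribution P V) C = P [set w | C (U w, V w)].
Proof.
move=> UV C mC.
have mW : measurable_fun setT (fun w => (U w, V w)) by exact: measurable_fun_pair.
pose W : {mfun Omega >-> (T1 * T2)%type} :=
  HB.pack (fun w => (U w, V w)) (isMeasurableFun.Build _ _ _ _ _ mW).
by apply: (@product_measure_unique _ _ _ _ _ _ _ (distribution P W)).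
Qed.

(** Plays the part of conditioning on [U]: Tonelli freezes [U], after which [V] may be replaced by
    any copy with the same law. It is applied to the current iterate and the next sample, with
    [(X, Y)] as the copy. *)
Lemma ge0_independent_integral (U : Omega -> T1) (V V' : Omega -> T2)
    (F : T1 * T2 -> \bar R) :
  measurable_fun setT U -> measurable_fun setT V -> measurable_fun setT V' ->
  independent_rv P U V -> identically_distributed P V V' ->
  measurable_fun [set: T1 * T2] F -> (forall z, 0 <= F z) ->
  \int[P]_w F (U w, V w) = \int[P]_w \int[P]_w' F (U w, V' w').
Proof.
move=> mU mV mV' UV VV' mF F0.
pose U0 : {mfun Omega >-> T1} := HB.pack U (isMeasurableFun.Build _ _ _ _ _ mU).
pose V0 : {mfun Omega >-> T2} := HB.pack V (isMeasurableFun.Build _ _ _ _ _ mV).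
have mW : measurable_fun setT (fun w => (U w, V w)) by exact: measurable_fun_pair.
transitivity (\int[distribution P U0 \x distribution P V0]_z F z).
  rewrite -[LHS](@ge0_integral_pushforward _ _ _ _ _ _ mW P setT F)//.
  apply: eq_measure_integral => C mC _; apply/esym.
  exact: (@independent_rv_pair U0 V0 UV C mC).
rewrite fubini_tonelli1//.
rewrite ge0_integral_pushforward//; last 2 first.
- exact: measurable_fun_fubini_tonelli_F.
- by move=> x _; apply: integral_ge0.
rewrite preimage_setT; apply: eq_integral => w _ /=; rewrite /fubini_F.
have mFU : measurable_fun setT (fun v => F (U w, v)).
  by apply: measurableT_comp => //; exact: measurable_pair1.
rewrite -[RHS](@ge0_integral_pushforward _ _ _ _ _ _ mV' P setT (fun v => F (U w, v)))//.
by apply: eq_measure_integral => C mC _; exact: VV'.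
Qed.

Lemma measurable_independent_integral (U : Omega -> T1) (V : Omega -> T2)
    (F : T1 * T2 -> \bar R) :
  measurable_fun setT U -> measurable_fun setT V ->
  measurable_fun [set: T1 * T2] F -> (forall z, 0 <= F z) ->
  measurable_fun setT (fun w => \int[P]_w' F (U w, V w')).
Proof.
move=> mU mV mF F0.
apply: (@measurableT_comp _ _ _ _ _ _ (fun u => \int[P]_w' F (u, V w'))) => //.
apply: (@measurable_fun_fubini_tonelli_F _ _ _ _ _ P (fun z => F (z.1, V z.2))).
- apply: measurableT_comp => //; apply: measurable_fun_pair => //.
  exact: measurableT_comp.
- by move=> z; exact: F0.
Qed.

End independence.

(** * Centred noise is orthogonal to functions of an independent variable *)

Section independent_noise.
Local Open Scope classical_set_scope.
Local Open Scope ereal_scope.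
Context d (Omega : measurableType d) (R : realType) (P : probability Omega R).

Lemma normal_prob_opp (sigma : R) (A : set R) : sigma != 0%R -> measurable A ->
  normal_prob 0 sigma (-%R @^-1` A) = normal_prob 0 sigma A.
Proof.
move=> s0 mA; rewrite /normal_prob.
have mN : measurable_fun [set: measurableTypeR R]
    (-%R : measurableTypeR R -> measurableTypeR R) by exact: measurable_funN.
have pdfN x : normal_pdf 0 sigma (- x) = normal_pdf 0 sigma x.
  by rewrite /normal_pdf (negbTE s0) /normal_fun !subr0 sqrrN.
pose f (x : R) := (normal_pdf 0 sigma x)%:E.
transitivity (\int[lebesgue_measure]_(x in -%R @^-1` A) (f \o -%R) x).
  by apply: eq_integral => x _; rewrite /f /= pdfN.
rewrite -(@ge0_integral_pushforward _ _ _ _ _ _ mN lebesgue_measure A f)//.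
- by apply: eq_measure_integral => B mB _; exact: lebesgue_measureN.
- apply/measurable_EFinP; apply: measurable_funTS; exact: measurable_normal_pdf.
- by move=> x _; rewrite lee_fin normal_pdf_ge0.
Qed.

(** By symmetry of the density [N] and [- N] have the same law, so the mean, finite by
    integrability, equals its opposite. *)
Lemma normal_expectation0 (sigma : R) (N : {RV P >-> R}) : sigma != 0%R ->
  (forall A, measurable A -> P (N @^-1` A) = normal_prob 0 sigma A) ->
  P.-integrable setT (EFin \o N) -> \int[P]_w (N w)%:E = 0.
Proof.
move=> s0 NE iN.
have mN : measurable_fun setT N by exact: measurable_funP.
have mM : measurable_fun setT (fun w => - N w)%R by exact: measurable_funN.
have NN : \int[P]_w (N w)%:E = \int[P]_w (- N w)%:E.
  have iM : P.-integrable setT (EFin \o (fun w => - N w)%R).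
    rewrite (_ : _ \o _ = -%E \o (EFin \o N))//; exact: integrableN.
  rewrite -[LHS](@integral_pushforward _ _ _ _ _ _ mN P setT EFin)//.
  rewrite -[RHS](@integral_pushforward _ _ _ _ _ _ mM P setT EFin)//.
  apply: eq_measure_integral => A mA _ /=; rewrite /pushforward NE//.
  rewrite -normal_prob_opp// -NE//.
  by apply: measurable_preimage => //; exact: measurable_funN.
have := NN; under [X in _ = X -> _]eq_integral do rewrite EFinN.
rewrite integralN//; last by rewrite integrable_add_def.
have : \int[P]_w (N w)%:E \is a fin_num by exact: integrable_fin_num.
by case: (\int[P]_w _) => // x _ [xx]; congr EFin; lra.
Qed.

Lemma independent_mean0 d1 (T1 : measurableType d1) (U : Omega -> T1)
    (N : {RV P >-> R}) (h : T1 -> R) :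
  measurable_fun setT U -> measurable_fun setT h -> independent_rv P U N ->
  P.-integrable setT (EFin \o N) -> \int[P]_w (N w)%:E = 0 ->
  P.-integrable setT (fun w => (h (U w) * N w)%:E) ->
  \int[P]_w (h (U w) * N w)%:E = 0.
Proof.
move=> mU mh UN iN N0 ihN.
have mN : measurable_fun setT N by exact: measurable_funP.
pose U0 : {mfun Omega >-> T1} := HB.pack U (isMeasurableFun.Build _ _ _ _ _ mU).
have mW : measurable_fun setT (fun w => (U w, N w)) by exact: measurable_fun_pair.
pose F (z : T1 * R) : \bar R := (h z.1 * z.2)%:E.
have mF : measurable_fun [set: T1 * R] F.
  apply/measurable_EFinP/measurable_funM; last exact: measurable_snd.
  by apply: measurableT_comp => //; exact: measurable_fst.
have iF : (distribution P U0 \x distribution P N).-integrable setT F.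
  have := @integrable_pushforward _ _ _ _ _ _ mW P setT F mF ihN measurableT.
  move=> /integrableP[_ iF]; apply/integrableP; split => //.
  apply: le_lt_trans iF; rewrite le_eqVlt; apply/orP; left; apply/eqP.
  apply: eq_measure_integral => C mC _.
  exact: (@independent_rv_pair _ _ _ _ _ _ _ _ U0 N UN C mC).
rewrite -[LHS](@integral_pushforward _ _ _ _ _ _ mW P setT F)//.
transitivity (\int[distribution P U0 \x distribution P N]_z F z).
  apply: eq_measure_integral => C mC _; apply/esym.
  exact: (@independent_rv_pair _ _ _ _ _ _ _ _ U0 N UN C mC).
rewrite -integral12_prod_meas1//; apply: integral0_eq => u _.
rewrite /fubini_F /F /=; under eq_integral do rewrite EFinM.
have iid : (distribution P N).-integrable setT EFin.
  exact: integrable_pushforward.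
rewrite integralZl// integral_pushforward// preimage_setT.
by rewrite [X in _ * X](_ : _ = 0) ?mule0.
Qed.

End independent_noise.

(** * A recursively defined state is independent of the next input *)

Section independent_recursion.
Local Open Scope classical_set_scope.
Local Open Scope ereal_scope.
Context d (Omega : measurableType d) (R : realType) (P : probability Omega R).

(** If [P E] is not zero, the law of [(U, V)] conditioned on [E] agrees on rectangles with the
    product of the unconditioned laws, hence everywhere. *)
Lemma independent_event_pair d1 d2 (T1 : measurableType d1)
    (T2 : measurableType d2) (U : Omega -> T1) (V : Omega -> T2) (E : set Omega) :
  measurable_fun setT U -> measurable_fun setT V -> measurable E ->
  independent_rv P U V ->
  (forall A B, measurable A -> measurable B ->
    P ((U @^-1` A `&` V @^-1` B) `&` E) = P (U @^-1` A) * P (V @^-1` B) * P E) ->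
  forall C : set (T1 * T2), measurable C ->
    P ([set w | C (U w, V w)] `&` E) = P [set w | C (U w, V w)] * P E.
Proof.
move=> mU mV mE UV UVE C mC.
have mW : measurable_fun setT (fun w => (U w, V w)) by exact: measurable_fun_pair.
have mCE : measurable [set w | C (U w, V w)] by exact: measurable_preimage mW mC.
have [E0|E0] := eqVneq (P E) 0.
  rewrite E0 mule0; apply/eqP; rewrite -measure_le0 -E0.
  by apply: le_measure; rewrite ?inE//; exact: measurableI.
have EE : P E = (fine (P E))%:E by rewrite fineK// fin_num_measure.
have e0 : fine (P E) != 0%R by rewrite fine_eq0// fin_num_measure.
(* The normalised restriction is the conditional probability given [E]. *)
pose Q : probability Omega R := mnormalize (mrestr P mE) P.
have QE A : Q A = P (A `&` E) * (fine (P E))^-1%:E.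
  rewrite /Q /= /mnormalize /= /mrestr setTI (negbTE E0) /=.
  by rewrite ifF//; apply/negbTE; rewrite EE.
pose U0 : {mfun Omega >-> T1} := HB.pack U (isMeasurableFun.Build _ _ _ _ _ mU).
pose V0 : {mfun Omega >-> T2} := HB.pack V (isMeasurableFun.Build _ _ _ _ _ mV).
pose W : {mfun Omega >-> (T1 * T2)%type} :=
  HB.pack (fun w => (U w, V w)) (isMeasurableFun.Build _ _ _ _ _ mW).
have : (distribution P U0 \x distribution P V0) C = distribution Q W C.
  apply: (@product_measure_unique _ _ _ _ _ _ _ (distribution Q W)) => // A B mA mB.
  transitivity (Q (U @^-1` A `&` V @^-1` B)) => //.
  rewrite QE (UVE A B)// -muleA [X in _ * (X * _)]EE -EFinM.
  by rewrite divff// mule1.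
rewrite (@independent_rv_pair _ _ _ _ _ _ _ _ U0 V0 UV C mC) => ->.
have -> : distribution Q W C = Q [set w | C (U w, V w)] by [].
rewrite QE -muleA [X in _ * (_ * X)]EE -EFinM.
by rewrite mulVf// mule1.
Qed.

Context d0 d1 (T0 : measurableType d0) (T1 : measurableType d1).
Variables (Z : nat -> Omega -> T1) (Phi : T0 * T1 -> T0) (s0 : T0).

Fixpoint recursion t w : T0 :=
  if t is t'.+1 then Phi (recursion t' w, Z t' w) else s0.

Hypothesis mZ : forall i, measurable_fun setT (Z i).
Hypothesis mPhi : measurable_fun [set: T0 * T1] Phi.
Hypothesis indepZ : mutually_independent P Z.

Lemma measurable_recursion t : measurable_fun setT (recursion t).
Proof.
elim: t => [|t IH] /=; first exact: measurable_cst.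
by apply: measurableT_comp => //; exact: measurable_fun_pair.
Qed.

Let window (B : nat -> set T1) m n : set Omega :=
  \bigcap_(i in [set i | m <= i < m + n]%N) (Z i @^-1` B i).

Let windowS B m n : window B m n.+1 = Z m @^-1` B m `&` window B m.+1 n.
Proof.
apply/seteqP; split=> w /=.
  move=> wB; split; first by apply: wB; rewrite /= leqnn addnS ltnS leq_addr.
  by move=> i /= /andP[mi im]; apply: wB => /=; rewrite (ltnW mi) addnS.
move=> [wm wB] i /= /andP[mi im]; move: mi; rewrite leq_eqVlt => /orP[/eqP <-//|mi].
by apply: wB; rewrite /= mi addSn -addnS.
Qed.

Let measurable_window B m n : (forall i, measurable (B i)) ->
  measurable (window B m n).
Proof.
by move=> mB; apply: bigcap_measurableType => i _; exact: measurable_preimage.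
Qed.

Let window_prob B m n : (forall i, measurable (B i)) ->
  P (window B m n) = \prod_(m <= i < m + n) P (Z i @^-1` B i).
Proof.
move=> mB; have := indepZ [fset i in index_iota m (m + n)]%fset mB.
rewrite [X in \bigcap_(i in X) _](_ : _ = [set i | m <= i < m + n]%N); last first.
  by apply/seteqP; split => i /=; rewrite !inE mem_index_iota.
rewrite -/(window B m n) => ->; apply: perm_big; apply: uniq_perm.
- exact: fset_uniq.
- exact: iota_uniq.
- by move=> i; rewrite !inE.
Qed.

(** Independence from [Z t] alone is not inductive. Independence from windows of every length is:
    the state at [t.+1] is a function of the state at [t] and [Z t], and a window of length [n.+1]
    from [t] supplies both [Z t] and the future. *)
Let recursion_window t n A B : measurable A -> (forall i, measurable (B i)) ->
  P (recursion t @^-1` A `&` window B t n) =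
  P (recursion t @^-1` A) * P (window B t n).
Proof.
elim: t n A B => [|t IH] n A B mA mB.
  have [As0|As0] := pselect (A s0).
    rewrite (_ : recursion 0 @^-1` A = setT); last by apply/seteqP; split.
    by rewrite setTI probability_setT mul1e.
  rewrite (_ : recursion 0 @^-1` A = set0); last by apply/seteqP; split.
  by rewrite set0I measure0 mul0e.
have split_window C D : measurable C -> measurable D ->
    P (recursion t @^-1` C `&` Z t @^-1` D `&` window B t.+1 n) =
    P (recursion t @^-1` C) * P (Z t @^-1` D) * P (window B t.+1 n).
  (* Overwriting the event at [t] turns the condition on [Z t] into the first slot of a longer
     window. *)
  move=> mC mD; pose B' i := if i == t then D else B i.
  have mB' i : measurable (B' i) by rewrite /B'; case: ifP.
  have B'E : window B' t.+1 n = window B t.+1 n.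
    apply: eq_bigcapr => i /= /andP[ti _].
    by rewrite /B' gtn_eqF.
  have := IH n.+1 C B' mC mB'; rewrite windowS B'E {1}/B' eqxx setIA => ->.
  rewrite -muleA; congr (_ * _).
  have -> : Z t @^-1` B' t `&` window B t.+1 n = window B' t n.+1.
    by rewrite windowS B'E.
  rewrite window_prob// big_ltn ?addnS ?ltnS ?leq_addr// {1}/B' eqxx.
  by rewrite -B'E window_prob// addSn.
apply: (independent_event_pair _ _ _ _ split_window (C := Phi @^-1` A)).
- exact: measurable_recursion.
- exact: mZ.
- exact: measurable_window.
- move=> C D mC mD; have := IH 1%N C (fun=> D) mC (fun=> mD).
  have -> : window (fun=> D) t 1 = Z t @^-1` D.
    by rewrite windowS [X in _ `&` X](_ : _ = setT) ?setIT//;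
      apply/seteqP; split => // w _ i /= /andP[]; rewrite addn0; lia.
  by [].
- exact: measurable_preimage.
Qed.

Lemma independent_recursion t : independent_rv P (recursion t) (Z t).
Proof.
move=> A B mA mB; have := @recursion_window t 1%N A (fun=> B) mA (fun=> mB).
have -> // : window (fun=> B) t 1 = Z t @^-1` B.
by rewrite windowS [X in _ `&` X](_ : _ = setT) ?setIT//;
  apply/seteqP; split => // w _ i /= /andP[]; rewrite addn0; lia.
Qed.

End independent_recursion.

(** * Excess loss under the polynomial model *)

Section polynomial_source.
Local Open Scope classical_set_scope.
Local Open Scope ereal_scope.
Context d (Omega : measurableType d) (R : realType) (P : probability Omega R).

Lemma integrable_dominated (f g : Omega -> R) :
  measurable_fun setT f -> P.-integrable setT (EFin \o g) ->
  (forall w, `|f w| <= g w)%R -> P.-integrable setT (EFin \o f).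
Proof.
move=> mf ig fg; apply: le_integrable ig => //.
- exact/measurable_EFinP.
- by move=> w _; rewrite /= lee_fin (le_trans (fg w))// ler_norm.
Qed.

Lemma integrable_mul (f g : Omega -> R) :
  measurable_fun setT f -> measurable_fun setT g ->
  P.-integrable setT (EFin \o (fun w => f w ^+ 2)%R) ->
  P.-integrable setT (EFin \o (fun w => g w ^+ 2)%R) ->
  P.-integrable setT (EFin \o (fun w => f w * g w)%R).
Proof.
move=> mf mg if2 ig2.
apply: (@integrable_dominated _ (fun w => f w ^+ 2 + g w ^+ 2)%R).
- exact: measurable_funM.
- rewrite (_ : _ \o _ = (fun w => (f w ^+ 2)%:E) \+ (fun w => (g w ^+ 2)%:E))//.
  exact: integrableD.
- move=> w; have := sqr_ge0 (f w - g w); have := sqr_ge0 (f w + g w).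
  by move=> ? ?; rewrite ler_norml; apply/andP; split; nra.
Qed.

Lemma expected_lossE (X Y : Omega -> R) f :
  expected_loss P X Y f = \int[P]_w ((X w - f (Y w)) ^+ 2)%:E.
Proof. by rewrite /expected_loss unlock. Qed.

Variables (k : nat).

Lemma measurable_polyfun (v : 'cV[R]_k) : measurable_fun setT (polyfun v).
Proof.
rewrite (_ : polyfun v = fun y => \sum_(i < k) v i 0 * y ^+ i)%R; last first.
  by apply/funext => y; rewrite polyfunE.
by apply: measurable_sum => i; exact: measurable_funM.
Qed.

Lemma measurable_weight : measurable_fun setT (@weight R k).
Proof.
rewrite (_ : @weight R k =
    fun y => (1 + \sum_(i < k) (y ^+ i) ^+ 2) `^ (-1))%R; last first.
  by apply/funext => y; rewrite powR_inv1// addr_ge0// sum_sq_ge0.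
apply: (@measurableT_comp _ _ _ _ _ _ (fun x : R => x `^ (-1))%R).
  exact: measurable_powR.
apply: measurable_funD => //; apply: measurable_sum => i.
by do 2 apply: measurable_funX.
Qed.

Lemma measurable_polyfun_pair (v : 'cV[R]_k) :
  measurable_fun [set: k.-tuple R * R]
    (fun p => polyfun (col_of p.1 - v) p.2).
Proof.
rewrite (_ : (fun p => _) = fun p : k.-tuple R * R =>
    (\sum_(i < k) (tnth p.1 i - v i 0) * p.2 ^+ i)%R); last first.
  by apply/funext => p; rewrite polyfunE; apply: eq_bigr => i _; rewrite !mxE.
apply: measurable_sum => i; apply: measurable_funM; last exact: measurable_funX.
apply: measurable_funB => //; exact: (measurableT_comp (measurable_tnth i)).
Qed.

Lemma measurable_sqnorm (v : 'cV[R]_k) :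
  measurable_fun [set: k.-tuple R] (fun s => sqnorm (col_of s - v)).
Proof.
rewrite (_ : (fun s => _) = fun s : k.-tuple R =>
    (\sum_(i < k) (tnth s i - v i 0) ^+ 2)%R); last first.
  by apply/funext => s; apply: eq_bigr => i _; rewrite !mxE.
apply: measurable_sum => i; apply: measurable_funX; apply: measurable_funB => //.
exact: measurable_tnth.
Qed.

Lemma measurable_sgd_step eta : measurable_fun [set: k.-tuple R * (R * R)]
  (fun p => sgd_step eta p.1 p.2).
Proof.
apply/measurable_fun_tnthP => i.
rewrite (_ : _ \o _ = fun p : k.-tuple R * (R * R) =>
    (tnth p.1 i - eta * weight k p.2.2 * (polyfun (col_of p.1 - 0) p.2.2 - p.2.1)
      * p.2.2 ^+ i)%R); last first.
  by apply/funext => p; rewrite /= tnth_mktuple subr0.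
have m2 : measurable_fun [set: k.-tuple R * (R * R)] (fun p => p.2.2).
  exact: measurableT_comp.
have m1 : measurable_fun [set: k.-tuple R * (R * R)] (fun p => p.2.1).
  exact: measurableT_comp.
apply: measurable_funB.
  exact: (measurableT_comp (measurable_tnth i)).
apply: measurable_funM; last exact: measurable_funX.
apply: measurable_funM.
  apply: measurable_funM => //; apply: measurableT_comp => //.
  exact: measurable_weight.
apply: measurable_funB => //.
apply: (measurableT_comp (measurable_polyfun_pair 0)
  (g := fun p : k.-tuple R * (R * R) => (p.1, p.2.2))).
exact: measurable_fun_pair.
Qed.

Section model.
Variables (beta : 'cV[R]_k) (sigma : R) (X Y N : {RV P >-> R}).
Hypothesis model : polynomial_model beta sigma X Y N.
Hypothesis sigma0 : (0 < sigma)%R.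

Let XE w : X w = (polyfun beta (Y w) + N w)%R.
Proof. by have [-> _ _ _ _] := model; rewrite polyfunE. Qed.

Let mY : measurable_fun setT Y. Proof. exact: measurable_funP. Qed.
Let mN : measurable_fun setT N. Proof. exact: measurable_funP. Qed.
Let mX : measurable_fun setT X. Proof. exact: measurable_funP. Qed.

Let mp (v : 'cV[R]_k) : measurable_fun setT (fun w => polyfun v (Y w)).
Proof. by apply: measurableT_comp => //; exact: measurable_polyfun. Qed.

(** The source of the second moments below: [v = 0] yields that of [X], [v = beta] that of the
    noise, and their combination that of every polynomial in [Y]. *)
Lemma sqr_loss_integrable (v : 'cV[R]_k) :
  P.-integrable setT (EFin \o (fun w => (X w - polyfun v (Y w)) ^+ 2)%R).
Proof.
apply/integrableP; split.
  by apply/measurable_EFinP/measurable_funX/measurable_funB.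
have [_ _ _ _ /(_ (polyfun v))] := model.
rewrite expected_lossE; under eq_integral => w _.
  rewrite -[X in X%:E]ger0_norm ?sqr_ge0//; over.
by apply; exists v.
Qed.

Lemma sqr_source_integrable : P.-integrable setT (EFin \o (fun w => X w ^+ 2)%R).
Proof.
have := sqr_loss_integrable 0; congr (_.-integrable _ (_ \o _)).
by apply/funext => w; rewrite polyfun0 subr0.
Qed.

Lemma sqr_noise_integrable : P.-integrable setT (EFin \o (fun w => N w ^+ 2)%R).
Proof.
have := sqr_loss_integrable beta; congr (_.-integrable _ (_ \o _)).
by apply/funext => w; rewrite XE addrAC subrr add0r.
Qed.

Lemma noise_integrable : P.-integrable setT (EFin \o N).
Proof.
apply: (@integrable_dominated _ (fun w => 1 + N w ^+ 2)%R) => //.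
- rewrite (_ : _ \o _ = cst 1 \+ (fun w => (N w ^+ 2)%:E))//.
  apply: integrableD => //; last exact: sqr_noise_integrable.
  exact: finite_measure_integrable_cst.
- move=> w; have := sqr_ge0 (N w - 1); have := sqr_ge0 (N w + 1).
  by move=> ? ?; rewrite ler_norml; apply/andP; split; nra.
Qed.

Lemma sqr_polyfun_integrable (v : 'cV[R]_k) :
  P.-integrable setT (EFin \o (fun w => polyfun v (Y w) ^+ 2)%R).
Proof.
(* The residual of the predictor [beta - v] is [polyfun v (Y w) + N w]. *)
apply: (@integrable_dominated _ (fun w =>
  2 * (X w - polyfun (beta - v) (Y w)) ^+ 2 + 2 * N w ^+ 2)%R).
- exact: measurable_funX.
- rewrite (_ : _ \o _ =
    (fun w => 2%:E * ((X w - polyfun (beta - v) (Y w)) ^+ 2)%:E)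
      \+ (fun w => 2%:E * (N w ^+ 2)%:E))//.
  apply: integrableD => //; apply: integrableZl => //.
    exact: sqr_loss_integrable.
  exact: sqr_noise_integrable.
- move=> w; rewrite XE polyfunB ger0_norm ?sqr_ge0//.
  by have := sqr_ge0 (polyfun v (Y w) + 2 * N w); nra.
Qed.

Lemma noise_orthogonal (h : R -> R) : measurable_fun setT h ->
  P.-integrable setT (fun w => (h (Y w) * N w)%:E) ->
  \int[P]_w (h (Y w) * N w)%:E = 0.
Proof.
move=> mh ihN; have [_ NE YN _ _] := model.
apply: independent_mean0 => //; first exact: noise_integrable.
apply: (normal_expectation0 (lt0r_neq0 sigma0) NE); exact: noise_integrable.
Qed.

Definition noise_power : \bar R := \int[P]_w (N w ^+ 2)%:E.

Definition excess (v : 'cV[R]_k) : \bar R := \int[P]_w (polyfun v (Y w) ^+ 2)%:E.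

Definition weighted_excess (v : 'cV[R]_k) : \bar R :=
  \int[P]_w (weight k (Y w) * polyfun v (Y w) ^+ 2)%:E.

(** Pythagoras: the cross term is a function of [Y] times the noise. *)
Lemma expected_loss_split (v : 'cV[R]_k) :
  expected_loss P X Y (polyfun v) = noise_power + excess (v - beta).
Proof.
rewrite expected_lossE.
have iaN : P.-integrable setT
    (EFin \o (fun w => polyfun (v - beta) (Y w) * N w)%R).
  apply: integrable_mul => //; first exact: sqr_polyfun_integrable.
  exact: sqr_noise_integrable.
transitivity (\int[P]_w ((N w ^+ 2)%:E + (polyfun (v - beta) (Y w) ^+ 2)%:E
   + (- 2)%:E * (polyfun (v - beta) (Y w) * N w)%:E)).
  apply: eq_integral => w _; rewrite -EFinM -!EFinD XE polyfunB; congr EFin.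
  by ring.
rewrite integralD//=; last 2 first.
- apply: integrableD => //; first exact: sqr_noise_integrable.
  exact: sqr_polyfun_integrable.
- exact: integrableZl.
rewrite integralD//=; last 2 first.
- exact: sqr_noise_integrable.
- exact: sqr_polyfun_integrable.
rewrite integralZl// (noise_orthogonal (measurable_polyfun _) iaN).
by rewrite mule0 adde0.
Qed.

Lemma noise_power_le_min_loss : noise_power <= min_loss P k X Y.
Proof.
apply: le_ereal_inf_tmp => _ [_ [v ->] <-].
rewrite expected_loss_split leeDl//; apply: integral_ge0 => w _.
by rewrite lee_fin sqr_ge0.
Qed.

(** Treats both excess losses at once: [g = 1] gives [excess] and [g = weight k] gives
    [weighted_excess] on the diagonal. *)
Let gram (g : R -> R) (u v : 'cV[R]_k) : R :=
  fine (\int[P]_w (g (Y w) * (polyfun u (Y w) * polyfun v (Y w)))%:E).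

Let gram_integrable (g : R -> R) (u v : 'cV[R]_k) : measurable_fun setT g ->
  (forall y, 0 <= g y <= 1)%R ->
  P.-integrable setT
    (EFin \o (fun w => g (Y w) * (polyfun u (Y w) * polyfun v (Y w)))%R).
Proof.
move=> mg g01.
have ipp : P.-integrable setT
    (EFin \o (fun w => polyfun u (Y w) * polyfun v (Y w))%R).
  by apply: integrable_mul => //; exact: sqr_polyfun_integrable.
apply: (@integrable_dominated _
  (Num.norm \o (fun w => polyfun u (Y w) * polyfun v (Y w))%R)).
- apply: measurable_funM; last exact: measurable_funM.
  exact: measurableT_comp.
- exact: integrable_norm.
- move=> w; have /andP[g0 g1] := g01 (Y w).
  by rewrite /= normrM ler_piMl// ger0_norm.
Qed.

Let gram_psd (g : R -> R) : measurable_fun setT g ->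
  (forall y, 0 <= g y <= 1)%R -> psd_form (gram g).
Proof.
move=> mg g01; split.
- move=> u v; rewrite /gram; congr fine; apply: eq_integral => w _.
  by rewrite (mulrC (polyfun u _)).
- move=> x u v w; rewrite /gram.
  have iu := gram_integrable u w mg g01.
  have iv := gram_integrable v w mg g01.
  transitivity (fine (\int[P]_t (
      x%:E * (g (Y t) * (polyfun u (Y t) * polyfun w (Y t)))%:E
      + (g (Y t) * (polyfun v (Y t) * polyfun w (Y t)))%:E))).
    congr fine; apply: eq_integral => t _; rewrite -EFinM -EFinD polyfunZD.
    by congr EFin; ring.
  rewrite integralD//=; last exact: integrableZl.
  rewrite integralZl//= fineD ?fineM// ?fin_numM//; exact: integrable_fin_num.
- move=> u; apply: fine_ge0; apply: integral_ge0 => w _; rewrite lee_fin.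
  by have /andP[g0 _] := g01 (Y w); rewrite mulr_ge0// -expr2 sqr_ge0.
Qed.

Let gramE (g : R -> R) (v : 'cV[R]_k) : measurable_fun setT g ->
  (forall y, 0 <= g y <= 1)%R ->
  (gram g v v)%:E = \int[P]_w (g (Y w) * polyfun v (Y w) ^+ 2)%:E.
Proof.
move=> mg g01; rewrite fineK; last exact/integrable_fin_num/gram_integrable.
by apply: eq_integral => w _; rewrite expr2.
Qed.

Let weight01 (y : R) : (0 <= weight k y <= 1)%R.
Proof. by rewrite ltW ?weight_gt0// weight_le1. Qed.

(* The two forms have the same kernel because the weight never vanishes; in
   finite dimension this makes them comparable, with a constant depending on
   the law of [Y]. *)
Lemma excess_le_weighted : exists2 C : R, (0 <= C)%R &
  forall v : 'cV[R]_k, excess v <= C%:E * weighted_excess v.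
Proof.
pose one : R -> R := cst 1%R.
have mone : measurable_fun setT one by exact: measurable_cst.
have one01 y : (0 <= one y <= 1)%R by rewrite ler01 lexx.
have A := gram_psd mone one01.
have B := gram_psd measurable_weight weight01.
(* A vanishing weighted integral forces [polyfun u (Y w) = 0] almost surely, since the weight is
   positive. *)
have ker u : gram (@weight R k) u u = 0%R -> gram one u u = 0%R.
  move=> gw0; have := congr1 EFin gw0; rewrite gramE//; last exact: measurable_weight.
  move=> w0; apply: EFin_inj; rewrite gramE//.
  have mw : measurable_fun setT
      (fun w => (weight k (Y w) * polyfun u (Y w) ^+ 2)%:E).
    apply/measurable_EFinP/measurable_funM; last exact: measurable_funX.
    by apply: measurableT_comp => //; exact: measurable_weight.
  have : ae_eq P setT (fun w => (weight k (Y w) * polyfun u (Y w) ^+ 2)%:E) (cst 0).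
    apply/ae_eq_integral_abs => //; rewrite -[RHS]w0; apply: eq_integral => w _.
    by rewrite gee0_abs// lee_fin mulr_ge0 ?sqr_ge0// ltW// weight_gt0.
  move=> ae0; rewrite (ae_eq_integral (cst 0))//; first by rewrite integral0.
    apply/measurable_EFinP/measurable_funM => //; exact: measurable_funX.
  apply: filterS ae0 => w /(_ I) [] /eqP; rewrite mulf_eq0.
  by rewrite gt_eqF ?weight_gt0//= => /eqP -> _; rewrite mulr0.
pose e j : 'cV[R]_k := \col_(i < k) (i == j :> nat)%:R.
have [C C0 CP] := psd_form_comparison A B ker k e.
exists C => // v; pose c j : R := (if insub j is Some i then v i 0 else 0)%R.
have vE : v = (\sum_(i < k) c i *: e i)%R.
  apply/colP => i; rewrite summxE (bigD1 i)//= big1 => [|j ji].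
    by rewrite !mxE eqxx mulr1 addr0 /c valK.
  by rewrite !mxE (_ : (i == j :> nat) = false) ?mulr0// eq_sym; exact/negbTE.
have := CP c; rewrite /= -vE -lee_fin EFinM gramE// gramE//; last first.
  exact: measurable_weight.
by apply: le_trans; rewrite /excess; under [leRHS]eq_integral do rewrite mul1r.
Qed.

Lemma weighted_excess_ge0 v : 0 <= weighted_excess v.
Proof.
apply: integral_ge0 => w _.
by rewrite lee_fin mulr_ge0 ?sqr_ge0// ltW// weight_gt0.
Qed.

(** * Energy inequality for the averaged iterates *)

Section sgd_risk.
Variables (q : R -> R) (eta : R).
Hypothesis mq : measurable_fun setT q.
Hypothesis eta06 : (0 <= eta <= 6^-1)%R.

Definition quantisation_error : \bar R := \int[P]_w ((q (X w) - X w) ^+ 2)%:E.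

Hypothesis iq :
  P.-integrable setT (EFin \o (fun w => (q (X w) - X w) ^+ 2)%R).

Definition step_cost : \bar R :=
  (3 * eta)%:E * quantisation_error + (3 * eta ^+ 2)%:E * noise_power.

(** The descent inequality integrated over a fresh sample, with the iterate held fixed. The term
    linear in the noise has coefficient [h (Y w)], a function of [Y] alone, so its mean is zero. *)
Lemma sgd_step_risk (s : k.-tuple R) :
  \int[P]_w (sqnorm (col_of (sgd_step eta s (q (X w), Y w)) - beta))%:E
    + eta%:E * weighted_excess (col_of s - beta)
  <= (sqnorm (col_of s - beta))%:E + step_cost.
Proof.
have /andP[eta0 eta6] := eta06.
pose a w := polyfun (col_of s - beta) (Y w).
have ma : measurable_fun setT a by exact: mp.
have mw : measurable_fun setT (fun w => weight k (Y w)).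
  by apply: measurableT_comp => //; exact: measurable_weight.
pose h y := (weight k y * polyfun (col_of s - beta) y)%R.
have mh : measurable_fun setT h.
  by apply: measurable_funM; [exact: measurable_weight|exact: measurable_polyfun].
have iaN : P.-integrable setT (EFin \o (fun w => a w * N w)%R).
  apply: integrable_mul => //; first exact: sqr_polyfun_integrable.
  exact: sqr_noise_integrable.
have ihN : P.-integrable setT (EFin \o (fun w => h (Y w) * N w)%R).
  apply: (@integrable_dominated _ (Num.norm \o (fun w => a w * N w)%R)).
  - by apply: measurable_funM => //; exact: measurableT_comp.
  - exact: integrable_norm.
  - move=> w; rewrite /= -mulrA normrM ler_piMl//.
    by rewrite ger0_norm ?weight_le1// ltW// weight_gt0.
have hN0 := noise_orthogonal mh ihN.
have mstep : measurable_fun setT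
    (fun w => sqnorm (col_of (sgd_step eta s (q (X w), Y w)) - beta)).
  apply: (measurableT_comp (measurable_sqnorm beta)).
  apply: (measurableT_comp (measurable_sgd_step eta)
    (g := fun w => (s, (q (X w), Y w)))).
  apply: measurable_fun_pair => //; apply: measurable_fun_pair => //.
  exact: measurableT_comp.
have mwa : measurable_fun setT (fun w => weight k (Y w) * a w ^+ 2)%R.
  by apply: measurable_funM => //; exact: measurable_funX.
have iN := sqr_noise_integrable.
rewrite /weighted_excess -ge0_integralZl//; last 2 first.
- exact/measurable_EFinP.
- by move=> w _; rewrite lee_fin mulr_ge0 ?sqr_ge0// ltW// weight_gt0.
rewrite -ge0_integralD//; last 4 first.
- by move=> w _; rewrite lee_fin sqnorm_ge0.
- exact/measurable_EFinP.
- move=> w _; rewrite mule_ge0// lee_fin mulr_ge0 ?sqr_ge0//.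
  by rewrite ltW// weight_gt0.
- exact/measurable_funeM/measurable_EFinP.
pose G w := (((sqnorm (col_of s - beta))%:E + (2 * eta)%:E * (h (Y w) * N w)%:E)
   + ((3 * eta)%:E * ((q (X w) - X w) ^+ 2)%:E + (3 * eta ^+ 2)%:E * (N w ^+ 2)%:E)).
have ic : P.-integrable setT (cst (sqnorm (col_of s - beta))%:E).
  exact: finite_measure_integrable_cst.
have i1 : P.-integrable setT (fun w => (2 * eta)%:E * (h (Y w) * N w)%:E).
  exact: integrableZl.
have i2 : P.-integrable setT (fun w => (3 * eta)%:E * ((q (X w) - X w) ^+ 2)%:E).
  exact: integrableZl.
have i3 : P.-integrable setT (fun w => (3 * eta ^+ 2)%:E * (N w ^+ 2)%:E).
  exact: integrableZl.
have iG : P.-integrable setT G by do 2 apply: integrableD => //.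
apply: (@le_trans _ _ (\int[P]_w G w)).
  apply: ge0_le_integral => //.
  - move=> w _; rewrite -EFinM -EFinD lee_fin addr_ge0 ?sqnorm_ge0//.
    by rewrite mulr_ge0// mulr_ge0 ?sqr_ge0// ltW// weight_gt0.
  - apply: emeasurable_funD; first exact/measurable_EFinP.
    exact/measurable_funeM/measurable_EFinP.
  - exact: measurable_int iG.
  - move=> w _; rewrite /G -!EFinM -!EFinD lee_fin.
    apply: le_trans (sgd_step_descent _ beta _ _ (N w) eta06) _.
    by rewrite -XE /h mulrA addrA.
rewrite integralD//=; last 2 first.
- exact: integrableD.
- exact: integrableD.
rewrite integralD//= integralD//= !integralZl// hN0 mule0 adde0.
rewrite integral_cst// [X in _ * X + _](_ : _ = 1) ?mule1//.
exact: probability_setT.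
Qed.

Variables (Xs Ys : nat -> {RV P >-> R}).
Hypothesis sample : iid_sample X Y Xs Ys.

Let Z i w : R * R := (Xs i w, Ys i w).

Definition sgd_state t w : k.-tuple R :=
  sgd eta (fun i => (q (Xs i w), Ys i w)) t.

(** Rounding is part of the step, so that the recursion is driven by the raw i.i.d. pairs. *)
Let Phi (p : k.-tuple R * (R * R)) : k.-tuple R :=
  sgd_step eta p.1 (q p.2.1, p.2.2).

Let sgd_stateE : sgd_state = recursion Z Phi [tuple 0%R | i < k].
Proof.
apply/funext => t; apply/funext => w; rewrite /sgd_state.
by elim: t => //= t ->.
Qed.

Let mZ i : measurable_fun setT (Z i).
Proof. by apply: measurable_fun_pair => //; exact: measurable_funP. Qed.

Let mPhi : measurable_fun [set: k.-tuple R * (R * R)] Phi.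
Proof.
apply: (measurableT_comp (measurable_sgd_step eta)
  (g := fun p : k.-tuple R * (R * R) => (p.1, (q p.2.1, p.2.2)))).
apply: measurable_fun_pair => //; apply: measurable_fun_pair.
  by apply: measurableT_comp => //; exact: measurableT_comp.
exact: measurableT_comp.
Qed.

Let mS t : measurable_fun setT (sgd_state t).
Proof. by rewrite sgd_stateE; exact: measurable_recursion. Qed.

Let sample_independent t : independent_rv P (sgd_state t) (Z t).
Proof.
rewrite sgd_stateE; apply: independent_recursion => //.
by have [] := sample.
Qed.

Let form (g : R -> R) (v : 'cV[R]_k) : \bar R :=
  \int[P]_w (g (Y w) * polyfun v (Y w) ^+ 2)%:E.

Let measurable_form (g : R -> R) (s : Omega -> k.-tuple R) :
  measurable_fun setT g -> (forall y : R, 0 <= g y)%R ->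
  measurable_fun setT s ->
  measurable_fun setT (fun w => form g (col_of (s w) - beta)).
Proof.
move=> mg g0 ms; pose F (p : k.-tuple R * R) : \bar R :=
  (g p.2 * polyfun (col_of p.1 - beta) p.2 ^+ 2)%:E.
apply: (@measurable_independent_integral _ _ _ P _ _ _ _ s Y F) => //.
- apply/measurable_EFinP/measurable_funM; first exact: measurableT_comp.
  by apply: measurable_funX; exact: measurable_polyfun_pair.
- by move=> p; rewrite lee_fin mulr_ge0 ?sqr_ge0.
Qed.

Let weight_ge0 (y : R) : (0 <= weight k y)%R. Proof. exact/ltW/weight_gt0. Qed.

Let measurable_weighted (s : Omega -> k.-tuple R) : measurable_fun setT s ->
  measurable_fun setT (fun w => weighted_excess (col_of (s w) - beta)).
Proof. by apply: measurable_form => //; exact: measurable_weight. Qed.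

Definition mean_sqnorm t : \bar R :=
  \int[P]_w (sqnorm (col_of (sgd_state t w) - beta))%:E.

Definition mean_weighted t : \bar R :=
  \int[P]_w weighted_excess (col_of (sgd_state t w) - beta).

Let step_cost_ge0 : 0 <= step_cost.
Proof.
have /andP[eta0 _] := eta06.
by apply: adde_ge0; apply: mule_ge0; rewrite ?lee_fin ?mulr_ge0 ?sqr_ge0//;
  apply: integral_ge0 => w _; rewrite lee_fin sqr_ge0.
Qed.

(** The current sample is exchanged for [(X, Y)] by independence from the iterate, then
    [sgd_step_risk] applies. Keeping the gap on the left avoids subtraction of extended reals. *)
Let mean_sqnormS t :
  mean_sqnorm t.+1 + eta%:E * mean_weighted t <= mean_sqnorm t + step_cost.
Proof.
have /andP[eta0 _] := eta06.
pose F (p : k.-tuple R * (R * R)) : \bar R :=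
  (sqnorm (col_of (Phi p) - beta))%:E.
have mF : measurable_fun [set: k.-tuple R * (R * R)] F.
  apply/measurable_EFinP; exact: (measurableT_comp (measurable_sqnorm beta)).
have F0 p : 0 <= F p by rewrite lee_fin sqnorm_ge0.
have mXY : measurable_fun setT (fun w => (X w, Y w)) by exact: measurable_fun_pair.
have -> : mean_sqnorm t.+1 =
    \int[P]_w \int[P]_w' F (sgd_state t w, (X w', Y w')).
  apply: (ge0_independent_integral (mS t) (mZ t) mXY) => //.
  by have [_] := sample; exact.
have mI := measurable_independent_integral P (mS t) mXY mF F0.
have mW := measurable_weighted (mS t).
rewrite /mean_weighted -ge0_integralZl//; last first.
  by move=> w _; exact: weighted_excess_ge0.
rewrite -ge0_integralD//; last 3 first.
- by move=> w _; apply: integral_ge0.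
- by move=> w _; rewrite mule_ge0// weighted_excess_ge0.
- exact: measurable_funeM.
have mQ : measurable_fun setT
    (fun w => (sqnorm (col_of (sgd_state t w) - beta))%:E).
  apply/measurable_EFinP; exact: (measurableT_comp (measurable_sqnorm beta)).
have -> : mean_sqnorm t + step_cost =
    \int[P]_w ((sqnorm (col_of (sgd_state t w) - beta))%:E + step_cost).
  rewrite ge0_integralD//; last by move=> w _; rewrite lee_fin sqnorm_ge0.
  rewrite integral_cst// [X in _ = _ + _ * X](_ : _ = 1) ?mule1//.
  exact: probability_setT.
apply: ge0_le_integral => //.
- move=> w _; rewrite adde_ge0//; first exact: integral_ge0.
  by rewrite mule_ge0// weighted_excess_ge0.
- by apply: emeasurable_funD => //; exact: measurable_funeM.
- exact: emeasurable_funD.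
- by move=> w _; exact: sgd_step_risk.
Qed.

Let mean_weighted_ge0 t : 0 <= mean_weighted t.
Proof. by apply: integral_ge0 => w _; exact: weighted_excess_ge0. Qed.

Let sum_mean_weighted T :
  mean_sqnorm T + eta%:E * (\sum_(t < T) mean_weighted t)
  <= (sqnorm beta)%:E + T%:R%:E * step_cost.
Proof.
have /andP[eta0 _] := eta06.
elim: T => [|T IH].
  rewrite big_ord0 mule0 mul0e !adde0 /mean_sqnorm.
  (* The recursion starts at 0, so the initial squared distance is that of [beta] from the
     origin. *)
  under eq_integral => w _.
    rewrite (_ : sqnorm _ = sqnorm beta); first over.
    apply: eq_bigr => i _; rewrite !mxE /sgd_state /= tnth_mktuple sub0r.
    by rewrite sqrrN.
  rewrite integral_cst// [X in _ * X](_ : _ = 1) ?mule1//.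
  exact: probability_setT.
rewrite big_ord_recr /= ge0_muleDr//; last by apply: sume_ge0.
rewrite (addeC (eta%:E * _)) addeA.
move: IH; set S := \sum_(t < T) _ => IH.
apply: (@le_trans _ _ (mean_sqnorm T + step_cost + eta%:E * S)).
  by apply: leeD => //; exact: mean_sqnormS.
rewrite addeAC -natr1 EFinD ge0_muleDl// mul1e [leRHS]addeA.
by apply: leeD.
Qed.

Definition sgd_output T w : 'cV[R]_k :=
  sgd_mean eta (fun i => (q (Xs i w), Ys i w)) T.

Lemma measurable_sgd_output T i : measurable_fun setT (fun w => sgd_output T w i 0%R).
Proof.
rewrite (_ : (fun w => _) =
    fun w => (T%:R^-1 * \sum_(t < T) tnth (sgd_state t w) i)%R); last first.
  apply/funext => w; rewrite /sgd_output /sgd_mean !mxE summxE; congr *%R.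
  by apply: eq_bigr => t _; rewrite mxE.
apply: measurable_funM => //; apply: measurable_sum => t.
exact: (measurableT_comp (measurable_tnth i)).
Qed.

(** Repacking the averaged column as a tuple lets the measurability results for iterates apply to
    the output. *)
Let sgd_output_tuple T w :
  col_of [tuple sgd_output T w i 0%R | i < k] = sgd_output T w.
Proof. by apply/colP => i; rewrite mxE tnth_mktuple. Qed.

Let measurable_output_tuple T :
  measurable_fun setT (fun w => [tuple sgd_output T w i 0%R | i < k]).
Proof.
apply/measurable_fun_tnthP => i.
rewrite (_ : _ \o _ = fun w => sgd_output T w i 0%R).
  exact: measurable_sgd_output.
by apply/funext => w; rewrite /= tnth_mktuple.
Qed.

Lemma measurable_sgd_output_weighted T :
  measurable_fun setT (fun w => weighted_excess (sgd_output T w - beta)).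
Proof.
under eq_fun do rewrite -sgd_output_tuple; exact: measurable_weighted.
Qed.

Lemma measurable_sgd_output_excess T :
  measurable_fun setT (fun w => excess (sgd_output T w - beta)).
Proof.
have /= := @measurable_form (cst 1%R) _ (measurable_cst _) (fun=> ler01)
  (measurable_output_tuple T).
rewrite /form; under eq_fun do under eq_integral do
  rewrite mul1r sgd_output_tuple.
exact.
Qed.

(** The telescoped energy inequality is divided by [eta * T]; Jensen passes from the average of the
    iterates' errors to the error of their average. *)
Lemma sgd_output_risk T : (0 < T)%N -> (0 < eta)%R ->
  \int[P]_w weighted_excess (sgd_output T w - beta)
  <= ((eta * T%:R)^-1 * sqnorm beta)%:E
     + 3%:E * quantisation_error + (3 * eta)%:E * noise_power.
Proof.
move=> T0 eta0.
have TR0 : (0 < T%:R :> R)%R by rewrite ltr0n.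
apply: (@le_trans _ _ (T%:R^-1%:E * \sum_(t < T) mean_weighted t)).
  rewrite /mean_weighted -ge0_integral_sum//; last 2 first.
  - by move=> t; exact: measurable_weighted.
  - by move=> t w _; exact: weighted_excess_ge0.
  have mW t : measurable_fun setT
      (fun w => weighted_excess (col_of (sgd_state t w) - beta)).
    exact: measurable_weighted.
  rewrite -ge0_integralZl//; last 2 first.
  - by apply: emeasurable_sum => t.
  - by move=> w _; apply: sume_ge0 => t _; exact: weighted_excess_ge0.
  apply: ge0_le_integral => //.
  - by move=> w _; exact: weighted_excess_ge0.
  - exact: measurable_sgd_output_weighted.
  - by apply: measurable_funeM; apply: emeasurable_sum => t.
  - move=> w _.
    have mt t : measurable_fun setT (fun w' => (weight k (Y w') *
        polyfun (col_of (sgd_state t w) - beta) (Y w') ^+ 2)%:E).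
      apply/measurable_EFinP/measurable_funM; last exact: measurable_funX.
      by apply: measurableT_comp => //; exact: measurable_weight.
    rewrite /weighted_excess -ge0_integral_sum//; last first.
      by move=> t w' _; rewrite lee_fin mulr_ge0 ?sqr_ge0// ltW// weight_gt0.
    rewrite -ge0_integralZl//; last 2 first.
    + by apply: emeasurable_sum => t.
    + move=> w' _; apply: sume_ge0 => t _.
      by rewrite lee_fin mulr_ge0 ?sqr_ge0// ltW// weight_gt0.
    apply: ge0_le_integral => //.
    + by move=> w' _; rewrite lee_fin mulr_ge0 ?sqr_ge0// ltW// weight_gt0.
    + apply/measurable_EFinP/measurable_funM; last exact: measurable_funX.
      by apply: measurableT_comp => //; exact: measurable_weight.
    + by apply: measurable_funeM; apply: emeasurable_sum => t.
    + move=> w' _; rewrite sumEFin -EFinM lee_fin -mulr_sumr [leRHS]mulrCA.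
      rewrite ler_wpM2l ?(ltW (weight_gt0 _ _))//.
      exact: sgd_mean_sqr_le.
have sumle : eta%:E * (\sum_(t < T) mean_weighted t)
    <= (sqnorm beta)%:E + T%:R%:E * step_cost.
  apply: le_trans (sum_mean_weighted T); rewrite leeDr//.
  by apply: integral_ge0 => w _; rewrite lee_fin sqnorm_ge0.
have -> : T%:R^-1%:E * \sum_(t < T) mean_weighted t =
    ((eta * T%:R)^-1)%:E * (eta%:E * (\sum_(t < T) mean_weighted t)).
  by rewrite muleA -EFinM; congr (_%:E * _); field; rewrite !gt_eqF.
apply: (@le_trans _ _ (((eta * T%:R)^-1)%:E *
    ((sqnorm beta)%:E + T%:R%:E * step_cost))).
  by rewrite lee_pmul2l// lte_fin invr_gt0 mulr_gt0.
have : quantisation_error \is a fin_num by exact: integrable_fin_num.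
have : noise_power \is a fin_num.
  exact/integrable_fin_num/sqr_noise_integrable.
rewrite /step_cost; case: noise_power => // p _; case: quantisation_error => // e _.
rewrite le_eqVlt; apply/orP; left; apply/eqP; congr EFin.
by field; rewrite !gt_eqF.
Qed.

End sgd_risk.

End model.

End polynomial_source.

(** * Quantisation and rate *)

Lemma inv_nat_cvg0 (R : realType) :
  ((fun m : nat => (m%:R^-1 : R)) @ \oo --> (0 : R))%classic.
Proof.
apply/gtr0_cvgV0; last exact/cvgrnyP.
by near=> m; rewrite ltr0n; near: m; exact: nbhs_infty_gt.
Unshelve. all: by end_near. Qed.

Section quantiser.
Context {R : realType}.
Implicit Types (m n : nat) (x : R).

(** Both tails are clipped: [truncn] is 0 on negative reals, which handles [x < - m], and [minn]
    handles [x > m]. *)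
Definition level m x : 'I_(2 * m ^ 2).+1 :=
  inord (minn (Num.truncn ((x + m%:R) * m%:R)) (2 * m ^ 2)).

(* The grid of step [1 / m] on [-m, m]; for [m = 0] the only value is [0]. *)
Definition grid_value m (j : 'I_(2 * m ^ 2).+1) : R := j%:R / m%:R - m%:R.

Definition quantise m x : R := grid_value (level m x).

Lemma levelE m x :
  level m x = minn (Num.truncn ((x + m%:R) * m%:R)) (2 * m ^ 2) :> nat.
Proof. by rewrite /level inordK// ltnS geq_minr. Qed.

Lemma quantise_error_in m x : (0 < m)%N -> `|x| <= m%:R ->
  `|quantise m x - x| <= m%:R^-1.
Proof.
move=> m0; have mR0 : 0 < m%:R :> R by rewrite ltr0n.
rewrite ler_norml => /andP[x1 x2]; set y := (x + m%:R) * m%:R.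
have y0 : 0 <= y by rewrite mulr_ge0 ?(ltW mR0)//; lra.
have y2 : y <= 2 * m%:R ^+ 2.
  by rewrite expr2 mulrA ler_wpM2r ?(ltW mR0)//; lra.
have /andP[t1 t2] := truncn_itv y0.
have levelt : level m x = Num.truncn y :> nat.
  rewrite levelE; apply/minn_idPl; rewrite truncn_le_nat (le_lt_trans y2)//.
  by rewrite -natrX -natrM ltr_nat.
have -> : quantise m x - x = ((Num.truncn y)%:R - y) * m%:R^-1.
  by rewrite /quantise /grid_value levelt /y; field; rewrite gt_eqF.
rewrite normrM [X in _ * X]ger0_norm ?invr_ge0 ?(ltW mR0)//.
rewrite ler_piMl ?invr_ge0 ?(ltW mR0)// ler_norml; rewrite -natr1 in t2.
by apply/andP; split; lra.
Qed.

(** A bound uniform in [m], needed for dominated convergence. Outside the grid the error is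
    [|x| - m] by clipping. *)
Lemma quantise_error_le m x : `|quantise m x - x| <= `|x| + 1.
Proof.
have [->|m0] := posnP m.
  rewrite /quantise /grid_value invr0 mulr0 subrr sub0r normrN.
  by rewrite lerDl.
have mR0 : 0 < m%:R :> R by rewrite ltr0n.
have [xm|xm] := leP `|x| m%:R.
  apply: le_trans (quantise_error_in m0 xm) _.
  by rewrite ler_wpDl// invf_le1// ler1n.
rewrite /quantise /grid_value; have [x0|x0] := leP 0 x.
  rewrite ger0_norm// in xm.
  have -> : level m x = (2 * m ^ 2)%N :> nat.
    rewrite levelE; apply/minn_idPr; rewrite truncn_ge_nat; last first.
      by rewrite mulr_ge0 ?(ltW mR0)//; lra.
    by rewrite natrM natrX expr2 mulrA ler_wpM2r ?(ltW mR0)//; lra.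
  rewrite natrM natrX expr2 mulrA mulfK ?gt_eqF// ler_norml.
  by rewrite ger0_norm//; apply/andP; split; lra.
rewrite ltr0_norm// in xm *.
have -> : level m x = 0%N :> nat.
  rewrite levelE; apply/eqP; rewrite -leqn0 geq_min truncn_le_nat.
  apply/orP; left; apply: (@le_lt_trans _ _ 0) => //.
  by rewrite nmulr_rle0 ?(ltW mR0)//; lra.
by rewrite mul0r sub0r ler_norml; apply/andP; split; lra.
Qed.

Lemma measurable_level m j : measurable [set x | level m x = j]%classic.
Proof.
have le n : measurable [set x | (level m x <= n)%N]%classic.
  have [mn|nm] := leqP (2 * m ^ 2)%N n.
    rewrite (_ : mkset _ = setT); first exact: measurableT.
    by apply/seteqP; split=> // x _ /=; rewrite levelE geq_min mn orbT.
  rewrite (_ : mkset _ = (fun x => (x + m%:R) * m%:R) @^-1` `]-oo, n.+1%:R[)%classic.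
    apply: measurable_preimage; last exact: measurable_itv.
    by apply: measurable_funM => //; exact: measurable_funD.
  by apply/seteqP; split=> x /=; rewrite levelE geq_min [X in _ || X]leqNgt nm;
    rewrite orbF truncn_le_nat in_itv.
have [j0|j0] := posnP j.
  rewrite (_ : mkset _ = [set x | (level m x <= 0)%N]%classic); first exact: le.
  apply/seteqP; split=> x /= => [->|]; first by rewrite j0.
  by rewrite leqn0 => /eqP l0; apply/val_inj; rewrite /= l0 j0.
rewrite (_ : mkset _ =
  [set x | (level m x <= j)%N] `\` [set x | (level m x <= j.-1)%N])%classic.
  by apply: measurableD; exact: le.
apply/seteqP; split=> x /= => [->|[h1 h2]]; first by split => //; lia.
by apply/val_inj => /=; lia.
Qed.

Lemma measurable_quantise m : measurable_fun setT (quantise m).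
Proof.
rewrite (_ : quantise m = fun x => \sum_(j < (2 * m ^ 2).+1)
    grid_value j * \1_([set x | level m x = j]%classic) x).
  apply: measurable_sum => j; apply: measurable_funM => //.
  by apply: measurable_indic; exact: measurable_level.
apply/funext => x; rewrite (bigD1 (level m x))//= big1 => [|j /eqP jl].
  by rewrite indicE mem_set// mulr1 addr0.
by rewrite indicE memNset ?mulr0// => /= /esym.
Qed.

End quantiser.

Section quantisation_limit.
Local Open Scope classical_set_scope.
Local Open Scope ereal_scope.
Context d (Omega : measurableType d) (R : realType) (P : probability Omega R).
Variable X : {RV P >-> R}.
Hypothesis iX : P.-integrable setT (EFin \o (fun w => X w ^+ 2)%R).

Let mX : measurable_fun setT X. Proof. exact: measurable_funP. Qed.

Let mqX m : measurable_fun setT (fun w => (quantise m (X w) - X w) ^+ 2)%R.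
Proof.
apply: measurable_funX; apply: measurable_funB => //.
by apply: measurableT_comp => //; exact: measurable_quantise.
Qed.

Let envelope : P.-integrable setT (EFin \o (fun w => 2 * X w ^+ 2 + 2)%R).
Proof.
rewrite (_ : _ \o _ = (fun w => 2%:E * (X w ^+ 2)%:E) \+ cst 2%:E)//.
apply: integrableD => //; first exact: integrableZl.
exact: finite_measure_integrable_cst.
Qed.

Let le_envelope m w : ((quantise m (X w) - X w) ^+ 2 <= 2 * X w ^+ 2 + 2)%R.
Proof.
rewrite -real_normK ?num_real//.
apply: (@le_trans _ _ ((`|X w| + 1) ^+ 2)%R).
  by rewrite lerXn2r ?nnegrE ?addr_ge0// quantise_error_le.
by rewrite -[X in (_ <= 2 * X + 2)%R]real_normK ?num_real//;
  have := sqr_ge0 (`|X w| - 1)%R; nra.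
Qed.

Lemma sqr_quantise_integrable m :
  P.-integrable setT (EFin \o (fun w => (quantise m (X w) - X w) ^+ 2)%R).
Proof.
apply: (integrable_dominated (mqX m) envelope) => w.
by rewrite ger0_norm ?sqr_ge0.
Qed.

(** Pointwise, once [m >= |X w|] the error is at most [1 / m]; the second moment of [X] provides the
    dominating function. *)
Lemma quantisation_error_cvg0 :
  (fun m => quantisation_error X (quantise m)) @ \oo --> 0.
Proof.
pose f m w := ((quantise m (X w) - X w) ^+ 2)%:E : \bar R.
have mf m : measurable_fun setT (f m) by exact/measurable_EFinP.
have f0 : {ae P, forall w, setT w -> f ^~ w @ \oo --> 0}.
  apply: aeW => w _.
  apply: (@squeeze_cvge _ _ _ _ (cst 0) _ (fun m => (m%:R^-1)%:E)).
  - near=> m; rewrite !lee_fin sqr_ge0 /=.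
    have m0 : (0 < m)%N by near: m; exact: nbhs_infty_gt.
    have m1 : (m%:R^-1 <= 1 :> R)%R by rewrite invf_le1 ?ltr0n// ler1n.
    have Xm : (`|X w| <= m%:R)%R by near: m; exact: nbhs_infty_ger.
    have qm := quantise_error_in m0 Xm.
    rewrite -real_normK ?num_real// expr2 (le_trans _ qm)// ler_piMr//.
    exact: le_trans qm m1.
  - exact: cvg_cst.
  - by apply: cvg_EFin; [near=> m|exact: inv_nat_cvg0].
have fE : {ae P, forall w m, setT w -> `|f m w| <= (2 * X w ^+ 2 + 2)%:E}.
  apply: aeW => w m _.
  by rewrite gee0_abs ?lee_fin ?sqr_ge0//; exact: le_envelope.
have [_ _] := dominated_convergence measurableT mf (measurable_cst _) f0 envelope fE.
by rewrite integral0.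
Unshelve. all: by end_near. Qed.

End quantisation_limit.
Section resolution.
Context {R : realType}.
Variable r : R.
Hypothesis r0 : 0 <= r.

(* The quantiser resolution used at blocklength [n]: [m ^ 2] samples are sent
   with [2 * m ^ 2 + 1] levels each, which costs at most [3 * m ^ 4] bits. *)
Definition resolution (n : nat) : nat :=
  \max_(m < n.+1 | (m ^ 2 <= n)%N && ((3 * m ^ 4)%:R <= r * n%:R)) m.

Lemma resolutionP n :
  (resolution n ^ 2 <= n)%N && ((3 * resolution n ^ 4)%:R <= r * n%:R).
Proof.
rewrite /resolution; elim/big_ind : _ => //.
- by rewrite muln0 mulr_ge0.
- by move=> a b ha hb; rewrite /maxn; case: ifP.
Qed.

Hypothesis r_gt0 : 0 < r.

(** A fixed resolution [M] costs a fixed number of bits, which [r * n] eventually exceeds because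
    [r > 0]. *)
Lemma resolution_ge M :
  exists n0, forall n, (n0 <= n)%N -> (M <= resolution n)%N.
Proof.
exists (maxn (M ^ 2) (Num.truncn ((3 * M ^ 4)%:R / r)).+1) => n.
rewrite geq_max => /andP[Mn rn].
have rM : (3 * M ^ 4)%:R <= r * n%:R.
  rewrite mulrC -ler_pdivrMr//; apply: ltW.
  by apply: lt_le_trans (truncnS_gt _) _; rewrite ler_nat.
have MnS : (M < n.+1)%N.
  by rewrite ltnS (leq_trans _ Mn)// -mulnn; case: (M) => // M'; rewrite leq_pmulr.
by apply: (@leq_bigmax_cond _ _ (fun m : 'I_n.+1 => m : nat) (Ordinal MnS));
  rewrite /= Mn.
Qed.

End resolution.

(** The crude bound [K <= 2 ^ K] is enough: the resolution grows as slowly as this estimate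
    demands. *)
Lemma log2_expn_le {R : realType} (K T : nat) : (0 < K)%N ->
  log2 ((K ^ T)%:R : R) <= (T * K)%:R.
Proof.
move=> K0; have KR0 : 0 < K%:R :> R by rewrite ltr0n.
have ln20 : 0 < ln 2 :> R by rewrite ln_gt0// ltr1n.
rewrite /log2 ler_pdivrMr// natrX lnXn// natrM -mulrA -[leLHS]mulr_natl.
rewrite ler_wpM2l// mulr_natl -lnXn// ler_ln ?posrE ?exprn_gt0//.
by rewrite -natrX ler_nat ltnW// ltn_expl.
Qed.

Lemma limn_esup_le {R : realType} (u : nat -> \bar R) (l : \bar R) :
  (forall e : R, 0 < e ->
    exists n0, forall n, (n0 <= n)%N -> (u n <= l + e%:E)%E) ->
  (limn_esup u <= l)%E.
Proof.
move=> ul; apply/lee_addgt0Pr => e e0; have [n0 un0] := ul e e0.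
apply: (@le_trans _ _ (ereal_sup [set u n | n in [set n | n0 <= n]%N])%classic).
  apply: ereal_inf_lbound; exists [set n | n0 <= n]%N%classic => //.
  by exists n0.
by apply: ge_ereal_sup => _ [n /= n0n <-]; exact: un0.
Qed.

Section sgd_facts.
Context {R : realType} (k : nat).

Lemma eq_sgd (eta : R) (z z' : nat -> R * R) t :
  (forall i, (i < t)%N -> z i = z' i) -> sgd (k := k) eta z t = sgd eta z' t.
Proof.
elim: t => //= t IH zz'; rewrite zz'// IH// => i it; exact/zz'/ltnW.
Qed.

(** Needed because the decoded sequence agrees with the rounded source only on its described
    prefix. *)
Lemma eq_sgd_mean (eta : R) (z z' : nat -> R * R) T :
  (forall i, (i < T)%N -> z i = z' i) ->
  sgd_mean (k := k) eta z T = sgd_mean eta z' T.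
Proof.
move=> zz'; rewrite /sgd_mean; congr (_ *: _); apply: eq_bigr => t _.
congr col_of; apply: eq_sgd => i it; apply: zz'; exact: ltn_trans it _.
Qed.

Lemma measurable_sgd d (T : measurableType d) (eta : R) (z : nat -> T -> R * R) t :
  (forall i, measurable_fun setT (z i)) ->
  measurable_fun setT (fun w => sgd (k := k) eta (z ^~ w) t).
Proof.
move=> mz; elim: t => [|t IH] /=; first exact: measurable_cst.
apply: (measurableT_comp (measurable_sgd_step eta)
  (g := fun w => (sgd eta (z ^~ w) t, z t w))).
exact: measurable_fun_pair.
Qed.

End sgd_facts.

(** * The coding scheme and its rate *)

Section regression_scheme.
Context {R : realType} (k : nat) (r : R).
Hypothesis r0 : 0 < r.

Let m n := resolution r n.

Definition codeword n := {ffun 'I_(m n ^ 2) -> 'I_(2 * m n ^ 2).+1}.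

Definition quantising_enc (v : R) n (x : n.-tuple R) : 'I_#|codeword n| :=
  enum_rank [ffun t : 'I_(m n ^ 2) => level (m n) (nth 0 x t)].

(** Positions from [m n ^ 2] on receive the filler 0; the learner stops before them. *)
Definition quantising_dec n (y : n.-tuple R) (c : 'I_#|codeword n|) : n.-tuple R :=
  [tuple if insub (i : nat) is Some t then grid_value (enum_val c t) else 0
  | i < n].

(** The step [1 / (6 m)] meets the cap [1/6] of the descent inequality for [m >= 1] and tends to 0,
    while step times horizon, [m / 6], tends to infinity. *)
Definition sgd_lrn n (y u : n.-tuple R) : R -> R :=
  polyfun (sgd_mean (k := k) (6 * (m n)%:R)^-1
    (fun i => (nth 0 u i, nth 0 y i)) (m n ^ 2)).

Lemma quantising_rate :
  (limn_esup (fun n => (log2 (#|codeword n|%:R : R) / n%:R)%:E) <= r%:E)%E.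
Proof.
apply: limn_esup_le => e e0; exists 0%N => n _; rewrite -EFinD lee_fin.
apply: (@le_trans _ _ r); last by rewrite lerDl ltW.
have [->|n0] := posnP n; first by rewrite invr0 mulr0 ltW.
rewrite ler_pdivrMr ?ltr0n//.
have /andP[_] := resolutionP (ltW r0) n; apply: le_trans.
rewrite card_ffun !card_ord; apply: le_trans (log2_expn_le _ _) _ => //.
(* [m ^ 2] samples at [2 m ^ 2 + 1] bits each: [2 m ^ 4 + m ^ 2 <= 3 m ^ 4]. *)
rewrite ler_nat -/(m n); case: (m n) => // a; nia.
Qed.

Let measurable_nth n i : measurable_fun [set: n.-tuple R] (fun x => nth 0 x i).
Proof.
have [ni|ni] := ltnP i n.
  rewrite (_ : (fun x => _) = (@tnth _ _)^~ (Ordinal ni)); first exact: measurable_tnth.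
  by apply/funext => x; rewrite (tnth_nth 0).
rewrite (_ : (fun x => _) = cst 0); first exact: measurable_cst.
by apply/funext => x; rewrite nth_default// size_tuple.
Qed.

Lemma measurable_quantising_enc v n (c : 'I_#|codeword n|) :
  measurable (quantising_enc v (n := n) @^-1` [set c])%classic.
Proof.
rewrite (_ : preimage _ _ = \bigcap_(t in [set: 'I_(m n ^ 2)])
    ((fun x : n.-tuple R => nth 0 x t) @^-1`
      [set x | level (m n) x = enum_val c t]))%classic.
  apply: fin_bigcap_measurable => // t _.
  apply: measurable_preimage; first exact: measurable_nth.
  exact: measurable_level.
apply/seteqP; split=> x /=.
  by move=> <- t _ /=; rewrite /quantising_enc enum_rankK ffunE.
move=> xc; apply: enum_val_inj; rewrite enum_rankK; apply/ffunP => t.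
by rewrite ffunE; exact: xc.
Qed.

Lemma measurable_quantising_dec n (c : 'I_#|codeword n|) :
  measurable_fun [set: n.-tuple R] (fun y => quantising_dec y c).
Proof. exact: measurable_cst. Qed.

Lemma sgd_lrn_polynomials n (y u : n.-tuple R) : polynomials k (sgd_lrn y u).
Proof. by eexists. Qed.

Lemma measurable_sgd_lrn n :
  measurable_fun [set: (n.-tuple R * n.-tuple R) * R]
    (fun p => sgd_lrn p.1.1 p.1.2 p.2).
Proof.
pose D : Type := (n.-tuple R * n.-tuple R * R)%type.
pose z i (p : D) := (nth 0 p.1.2 i, nth 0 p.1.1 i).
pose eta : R := (6 * (m n)%:R)^-1.
have mz i : measurable_fun setT (z i).
  have m1 : measurable_fun [set: D] (fun p => p.1.1) by exact: measurableT_comp.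
  have m2 : measurable_fun [set: D] (fun p => p.1.2) by exact: measurableT_comp.
  apply: measurable_fun_pair.
    exact: (measurableT_comp (@measurable_nth n i) m2).
  exact: (measurableT_comp (@measurable_nth n i) m1).
rewrite (_ : (fun p => _) = fun p => \sum_(i < k)
  ((m n ^ 2)%:R^-1 * \sum_(t < m n ^ 2) tnth (sgd eta (z ^~ p) t) i) * p.2 ^+ i).
  apply: measurable_sum => i; apply: measurable_funM; last exact: measurable_funX.
  apply: measurable_funM => //; apply: measurable_sum => t.
  apply: (measurableT_comp (measurable_tnth i)); exact: measurable_sgd.
apply/funext => p; rewrite /sgd_lrn polyfunE; apply: eq_bigr => i _.
rewrite !mxE summxE; congr (_ * _ * _); apply: eq_bigr => t _.
by rewrite mxE.
Qed.

Definition sgd_scheme : scheme k r :=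
  Scheme quantising_rate sgd_lrn_polynomials measurable_quantising_enc
    measurable_quantising_dec measurable_sgd_lrn.

(** Links code and analysis: decoding inverts the enumeration of codewords, and [m n ^ 2 <= n]
    ensures that every sample read lies in the block. *)
Lemma predictor_sgd_scheme (v : R) n d (Omega : measurableType d)
    (P : probability Omega R) (Xs Ys : nat -> {RV P >-> R}) w :
  predictor sgd_scheme v [tuple Xs i w | i < n] [tuple Ys i w | i < n] =
  polyfun (sgd_output k (quantise (m n)) (6 * (m n)%:R)^-1 Xs Ys (m n ^ 2) w).
Proof.
rewrite /predictor /= /sgd_lrn /sgd_output; congr polyfun.
apply: eq_sgd_mean => i im.
have /andP[mn _] := resolutionP (ltW r0) n.
have ni : (i < n)%N by exact: leq_trans mn.
have nthE (T : Type) (x0 : T) (f : 'I_n -> T) :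
    nth x0 [tuple f j | j < n] i = f (Ordinal ni).
  by rewrite -[i]/(nat_of_ord (Ordinal ni)) -tnth_nth tnth_mktuple.
rewrite !nthE /=; congr pair.
by rewrite (insubT (fun j => j < m n ^ 2)%N im) /quantising_enc enum_rankK ffunE nthE.
Qed.

End regression_scheme.

(** The constants come from [eta = 1 / (6 m)] and [T = m ^ 2]: [1 / (eta * T) = 6 / m] and
    [3 * eta = 1 / (2 m)]. The factor [C] pays for passing from excess to weighted excess. *)
Lemma mean_gen_error_le (R : realType) (k : nat) (r : R) (r0 : 0 < r)
    (sigma : R) (beta : 'cV[R]_k) (d : measure_display)
    (Omega : measurableType d) (P : probability Omega R)
    (X Y N : {RV P >-> R}) (Xs Ys : nat -> {RV P >-> R}) (C v : R) (n : nat) :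
  0 < sigma -> polynomial_model beta sigma X Y N -> iid_sample X Y Xs Ys ->
  0 <= C -> (forall u : 'cV[R]_k, excess Y u <= C%:E * weighted_excess Y u)%E ->
  (0 < resolution r n)%N ->
  let m := resolution r n in
  (mean_gen_error (sgd_scheme k r0) v X Y Xs Ys n <=
   noise_power N + C%:E * ((6 * sqnorm beta / m%:R)%:E
     + 3%:E * quantisation_error X (quantise m)
     + (m%:R^-1 / 2)%:E * noise_power N))%E.
Proof.
move=> sigma0 model sample C0 CP; cbv zeta; set m := resolution r n => m0.
have mR0 : 0 < m%:R :> R by rewrite ltr0n.
have mR1 : 1 <= m%:R :> R by rewrite ler1n.
pose eta : R := (6 * m%:R)^-1.
have eta0 : 0 < eta by rewrite invr_gt0 mulr_gt0.
have eta6 : 0 <= eta <= 6^-1.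
  by rewrite ltW//= lef_pV2 ?posrE ?mulr_gt0// ler_peMr.
pose out := sgd_output k (quantise m) eta Xs Ys (m ^ 2).
have iX := sqr_source_integrable model.
have mq := @measurable_quantise R m.
have mE := measurable_sgd_output_excess beta Y eta mq Xs Ys (m ^ 2).
have mW := measurable_sgd_output_weighted beta Y eta mq Xs Ys (m ^ 2).
have E0 u : (0 <= excess Y u)%E.
  by apply: integral_ge0 => w _; rewrite lee_fin sqr_ge0.
have np0 : (0 <= noise_power N)%E.
  by apply: integral_ge0 => w _; rewrite lee_fin sqr_ge0.
have -> : mean_gen_error (sgd_scheme k r0) v X Y Xs Ys n =
    (noise_power N + \int[P]_w excess Y (out w - beta))%E.
  transitivity (\int[P]_w (noise_power N + excess Y (out w - beta)))%E.
    apply: eq_integral => w _; rewrite /gen_error predictor_sgd_scheme.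
    by rewrite (expected_loss_split model sigma0).
  rewrite ge0_integralD// integral_cst//.
  by rewrite [X in (_ * X + _)%E](_ : _ = 1%E) ?mule1//; exact: probability_setT.
apply: leeD => //.
apply: (@le_trans _ _ (C%:E * \int[P]_w weighted_excess Y (out w - beta))%E).
  rewrite -ge0_integralZl//; last by move=> w _; exact: weighted_excess_ge0.
  by apply: ge0_le_integral => //; exact: measurable_funeM.
apply: lee_wpmul2l => //.
have T0 : (0 < m ^ 2)%N by rewrite expn_gt0 m0.
have := sgd_output_risk model sigma0 mq eta6 (sqr_quantise_integrable iX m)
  sample T0 eta0.
by congr (_ <= _%:E + _ + _%:E * _)%E; rewrite /eta ?natrX; field;
  rewrite ?gt_eqF.
Qed.

Theorem theorem1 (R : realType) (k : nat) (r : R) (hr : 0 < r) :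
  achievable k r 0.
Proof.
exists (sgd_scheme k hr) => sigma beta d Omega P X Y N Xs Ys sigma0 model sample.
rewrite adde0; apply: le_trans (noise_power_le_min_loss model sigma0).
have [C C0 CP] := excess_le_weighted model.
have iX := sqr_source_integrable model.
have npE : noise_power N = (fine (noise_power N))%:E.
  by rewrite fineK//; exact/integrable_fin_num/(sqr_noise_integrable model).
pose eps m := fine (quantisation_error X (quantise m)).
have epsE m : quantisation_error X (quantise m) = (eps m)%:E.
  by rewrite fineK//; exact/integrable_fin_num/sqr_quantise_integrable.
pose bound m := C * (6 * sqnorm beta * m%:R^-1 + 3 * eps m
  + m%:R^-1 / 2 * fine (noise_power N)).
have eps0 : (eps @ \oo --> (0 : R))%classic.
  by have /fine_cvgP[] := quantisation_error_cvg0 iX.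
have bound0 : (bound @ \oo --> (0 : R))%classic.
  rewrite [X in (_ --> X)%classic](_ : _ = C * (6 * sqnorm beta * 0 + 3 * 0
    + 0 / 2 * fine (noise_power N))); last by rewrite !mulr0 !mul0r !addr0 mulr0.
  apply: cvgMr; apply: cvgD.
    by apply: cvgD; apply: cvgMr => //; exact: inv_nat_cvg0.
  by apply: cvgMl; apply: cvgMl; exact: inv_nat_cvg0.
apply: limn_esup_le => e e0.
have [M _ MP] := cvgr_lt _ bound0 _ e0.
(* The 1 guarantees a positive resolution, as [mean_gen_error_le] requires. *)
have [n0 n0P] := resolution_ge hr (maxn M 1).
exists n0 => n /n0P; rewrite geq_max => /andP[Mm m0].
apply: le_trans (mean_gen_error_le hr (sigma ^+ 2) sigma0 model sample C0 CP m0) _.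
rewrite npE epsE.
rewrite [leLHS](_ : _ = (fine (noise_power N) + bound (resolution r n))%:E)//.
by rewrite -EFinD lee_fin lerD2l; apply: ltW; exact: MP.
Qed.
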